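(* For $1\leq j\leq k$, let $f_j\in A^2_{\alpha_j}$ with $\alpha_j\geq 1$. Set $f:=f_1f_2\cdots f_k$ and $\alpha:=\alpha_1+\alpha_2+\cdots+\alpha_k$. Then $$\|f\|_{A^2_\alpha}\leq \|f_1\|_{A^2_{\alpha_1}}\|f_2\|_{A^2_{\alpha_2}}\cdots\|f_k\|_{A^2_{\alpha_k}}.$$ Equality in this inequality occurs if and only if there are constants $\lambda_j\in\mathbb{C}$ and $w\in\mathbb{D}$ such that $f_j(z)=\lambda_j(1-wz)^{-\alpha_j}$ for every $1\leq j\leq k$.
   Context: $\mathbb{D}$ is the open unit disc in $\mathbb{C}$, and $k$ is a positive integer. For $0<p<\infty$ and $\alpha>1$, the Bergman space $A^p_\alpha$ is the closure of the set of analytic polynomials with respect to the (quasi-)norm $$\|f\|_{A^p_\alpha}=\left(\int_{\mathbb{D}}|f(z)|^p(\alpha-1)(1-|z|^2)^{\alpha}\,d\mu(z)\right)^{1/p},\qquad d\mu(z)=\frac{1}{(1-|z|^2)^2}\frac{dx\,dy}{\pi}\quad(z=x+iy).$$ For $\alpha=1$ the convention is $A^p_1:=H^p$, the Hardy space of analytic $f$ in $\mathbb{D}$ with $\|f\|_{H^p}=\sup_{0<r<1}\left(\int_0^{2\pi}|f(re^{i\theta})|^p\frac{d\theta}{2\pi}\right)^{1/p}<\infty$. For $p=2$ and $f(z)=\sum_{n\ge0}a_nz^n$ one has $\|f\|_{A^2_\alpha}^2=\sum_{n\geq0}|a_n|^2/c_\alpha(n)$ for all $\alpha\ge1$, where $c_\alpha(n)=\binom{n+\alpha-1}{n}$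 is the coefficient of $z^n$ in $(1-z)^{-\alpha}$.
   Formalization: The ''only if'' part of the equality statement is proved for k ≥ 2 and when no f_j vanishes identically on the disc; it fails otherwise, e.g. for k = 1, f_1(z) = z, or for f_1 = 0, f_2(z) = z, where equality is automatic. *)

(* Defs.v *)
From HB Require Import structures.
From mathcomp Require Import all_boot all_order all_algebra.
From mathcomp Require Import complex.
From mathcomp Require Import all_classical all_reals all_analysis.

Set Implicit Arguments.
Unset Strict Implicit.
Unset Printing Implicit Defensive.

Import Order.TTheory GRing.Theory Num.Theory numFieldNormedType.Exports.

Local Open Scope classical_set_scope.
Local Open Scope complex_scope.
Local Open Scope ring_scope.

(* The modulus as an element of R (the norm of R[i] takes values in R[i]). *)
Definition cmod (R : realType) (z : R[i]) : R := ComplexField.Normc.normc z.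

Definition disc (R : realType) : set R[i] := [set z | cmod z < 1].

(* Analyticity on the disc: f is represented by a power series on every open
   disc of centre z0 and radius r contained in the unit disc. Functions are
   total, but only their values on the unit disc are ever used. *)
Definition analytic_on_disc (R : realType) (f : R[i] -> R[i]) : Prop :=
  forall (z0 : R[i]) (r : R), 0 < r ->
    (forall z, cmod (z - z0) < r -> disc z) ->
    exists c : nat -> R[i], forall z, cmod (z - z0) < r ->
      (fun n => cmod (f z - \sum_(m < n) c m * (z - z0) ^+ m)) @ \oo --> (0 : R).

(* The weight is (alpha - 1) (1 - |z|^2)^alpha dmu(z), with
   dmu(z) = (1 - |z|^2)^-2 dx dy / pi. *)
Definition bergman_norm (R : realType) (p alpha : R) (f : R[i] -> R[i]) : \bar R :=
  ((\int[lebesgue_measure \x lebesgue_measure]_(xy in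
       [set xy : R * R | disc (xy.1 +i* xy.2)])
      ((cmod (f (xy.1 +i* xy.2)) `^ p
        * ((alpha - 1) * (1 - cmod (xy.1 +i* xy.2) ^+ 2) `^ alpha)
        * ((1 - cmod (xy.1 +i* xy.2) ^+ 2) ^- 2 / pi))%R)%:E) `^ p^-1)%E.

Definition hardy_norm (R : realType) (p : R) (f : R[i] -> R[i]) : \bar R :=
  ereal_sup [set
    ((\int[lebesgue_measure]_(t in `[0%R, (2 * pi)%R])
        ((cmod (f (r * cos t +i* (r * sin t))) `^ p / (2 * pi))%R)%:E) `^ p^-1)%E
    | r in [set r : R | 0 < r < 1]].

Definition Anorm (R : realType) (p alpha : R) (f : R[i] -> R[i]) : \bar R :=
  if alpha == 1 then hardy_norm p f else bergman_norm p alpha f.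

(* For alpha = 1 this is the Hardy space H^p. For alpha > 1 it is the closure of
   the polynomials, whose elements are identified with their analytic
   representatives. *)
Definition Aspace (R : realType) (p alpha : R) : set (R[i] -> R[i]) :=
  [set f | analytic_on_disc f /\
    if alpha == 1 then (hardy_norm p f < +oo)%E : Prop
    else forall e : R, 0 < e -> exists P : {poly R[i]},
      (bergman_norm p alpha (fun z => (f z - P.[z])%R) < e%:E)%E].

(* Principal branch of z^s on the half-plane 0 < Re z, where the principal
   argument of z is atan (Im z / Re z). It is only applied at 1 - w z with
   |w z| < 1, which lies in that half-plane. *)
Definition cpow (R : realType) (z : R[i]) (s : R) : R[i] :=
  let theta := atan (complex.Im z / complex.Re z) in
  (cmod z `^ s * cos (s * theta)) +i* (cmod z `^ s * sin (s * theta)).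

(* Main.v *)
(* Write f_j = sum_n a_j(n) z^n. In each space the squared norm of a function with
   coefficients a is sum_n |a(n)|^2 / c_alpha(n): Parseval's identity on circles
   gives the Hardy case, and polar coordinates together with a beta integral give
   the Bergman case. For two functions, put a = c_alpha x and b = c_beta y; as
   sum_(i <= N) c_alpha(i) c_beta(N - i) = c_(alpha + beta)(N), Cauchy-Schwarz with
   the weights c_alpha(i) c_beta(N - i) bounds the N-th coefficient of the product
   and its defect is, by Lagrange's identity, a sum of multiples of
   |x(i) y(N - i) - x(j) y(N - j)|^2. Summing over N gives the inequality, and
   equality forces x(i) y(N - i) to depend on N only, so that x and y are geometric
   with a common ratio w. The general case follows by induction on the number of
   factors. *)
Require Import Defs.
From HB Require Import structures.
From mathcomp Require Import all_boot all_order all_algebra.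
From mathcomp Require Import complex.
From mathcomp Require Import all_classical all_reals all_analysis.
From mathcomp Require Import measurable_realfun ring lra.

Import Order.TTheory GRing.Theory Num.Theory numFieldNormedType.Exports.

Set Implicit Arguments.
Unset Strict Implicit.
Unset Printing Implicit Defensive.

Local Open Scope classical_set_scope.
Local Open Scope complex_scope.
Local Open Scope ring_scope.

(** * Modulus, Cauchy products and convergence *)

(** Norms and membership are transferred to coefficient sequences: [represents f a] ties a function
    to its expansion at 0, and [sqnorm al a X] says at once that the weighted sum converges and that
    its value is [X]. The analysis is shaped by the wish to work with one real variable at a time.
    Polar coordinates come from two scalings of the line with Tonelli in between, so the angle
    appears as [atan u] with [u] on the whole line, and Parseval's identity is needed a second time
    in that parametrization. The series of [(1 - z) ^ (- al)] is summed along the segment from 0 to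
    [z] by a differential equation in a real parameter. In the equality case, an induction that
    assumes equality alone breaks down at a single factor, where equality carries no information;
    hence the stronger induction hypothesis that the whole product is already geometric with a known
    ratio. *)

Section Cmod.
Variable R : realType.
Implicit Types z w : R[i].

Lemma cmod0 : cmod (0 : R[i]) = 0. Proof. exact: ComplexField.Normc.normc0. Qed.

Lemma cmod1 : cmod (1 : R[i]) = 1. Proof. exact: ComplexField.Normc.normc1. Qed.

Lemma cmodM z w : cmod (z * w) = cmod z * cmod w.
Proof. exact: ComplexField.Normc.normcM. Qed.

Lemma cmodN z : cmod (- z) = cmod z.
Proof. by case: z => a b; rewrite /cmod /= !sqrrN. Qed.

Lemma cmodX z n : cmod (z ^+ n) = cmod z ^+ n.
Proof. by elim: n => [|n ih]; rewrite ?expr0 ?cmod1// !exprS cmodM ih. Qed.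

Lemma cmod_ge0 z : 0 <= cmod z. Proof. by case: z => a b; exact: sqrtr_ge0. Qed.

Lemma cmod_eq0 z : (cmod z == 0) = (z == 0).
Proof.
apply/eqP/eqP => [|->]; last exact: cmod0.
exact: ComplexField.Normc.eq0_normc.
Qed.

Lemma cmod_norm z : (cmod z)%:C = `|z|. Proof. by case: z. Qed.

Lemma cmodD z w : cmod (z + w) <= cmod z + cmod w.
Proof. by rewrite -lecR rmorphD /= !cmod_norm ler_normD. Qed.

Lemma cmod_sub z w : cmod (z - w) = cmod (w - z).
Proof. by rewrite -opprB cmodN. Qed.

Lemma cmod_sum (I : Type) (s : seq I) (P : pred I) (F : I -> R[i]) :
  cmod (\sum_(i <- s | P i) F i) <= \sum_(i <- s | P i) cmod (F i).
Proof.
elim/big_ind2 : _ => //; first by rewrite cmod0.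
by move=> x1 x2 y1 y2 h1 h2; apply: le_trans (cmodD _ _) _; exact: lerD.
Qed.

Lemma cmod_dist z w : `|cmod z - cmod w| <= cmod (z - w).
Proof.
have := cmodD (z - w) w; rewrite subrK.
have := cmodD (w - z) z; rewrite subrK cmod_sub.
by move=> h1 h2; rewrite ler_norml; apply/andP; split; lra.
Qed.

Lemma cmodE z : cmod z = Num.sqrt (complex.Re z ^+ 2 + complex.Im z ^+ 2).
Proof. by case: z. Qed.

Lemma sqr_cmod z : cmod z ^+ 2 = complex.Re z ^+ 2 + complex.Im z ^+ 2.
Proof. by rewrite cmodE sqr_sqrtr// addr_ge0 ?sqr_ge0. Qed.

Lemma cmodC (x : R) : cmod x%:C = `|x|.
Proof. by rewrite cmodE /= expr0n /= addr0 sqrtr_sqr. Qed.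

Lemma cmodV z : cmod z^-1 = (cmod z)^-1.
Proof. exact: ComplexField.Normc.normcV. Qed.

Lemma Re_cmod z : `|complex.Re z| <= cmod z.
Proof. by rewrite cmodE -sqrtr_sqr ler_wsqrtr// lerDl sqr_ge0. Qed.

Lemma Im_cmod z : `|complex.Im z| <= cmod z.
Proof. by rewrite cmodE -sqrtr_sqr ler_wsqrtr// lerDr sqr_ge0. Qed.

End Cmod.

Section Conv.
Variable K : comNzRingType.
Implicit Types a b : nat -> K.

Definition cauchy_prod a b (n : nat) : K := \sum_(i < n.+1) a i * b (n - i)%N.

Definition unit_seq (n : nat) : K := (n == 0)%:R.

Lemma cauchy_prod_unit a : cauchy_prod a unit_seq = a.
Proof.
apply/funext => n; rewrite /cauchy_prod big_ord_recr /= subnn /unit_seq eqxx mulr1.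
rewrite big1 ?add0r// => i _.
by rewrite (_ : (n - i)%N == 0%N = false) ?mulr0// subn_eq0 leqNgt ltn_ord.
Qed.

Lemma sum_cauchy_prod a b N : \sum_(n < N) cauchy_prod a b n =
  \sum_(i < N) a i * \sum_(j < N - i) b j.
Proof.
elim: N => [|N ih]; first by rewrite !big_ord0.
rewrite big_ord_recr /= ih [RHS]big_ord_recr /= subSnn big_ord1.
rewrite /cauchy_prod big_ord_recr /= subnn addrA -big_split /=; congr (_ + _).
apply: eq_bigr => i _.
by rewrite subSn ?(ltnW (ltn_ord i))// big_ord_recr /= mulrDr.
Qed.

(** What remains of the square of index pairs below [N] is the part with [N <= i + j]. As an
    explicit sum, it lets the complex remainder be bounded term by term by the remainder of the
    moduli. *)
Lemma prod_sum_sub_cauchy_prod a b N :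
  (\sum_(i < N) a i) * (\sum_(i < N) b i) - \sum_(n < N) cauchy_prod a b n =
  \sum_(i < N) a i * \sum_(N - i <= j < N) b j.
Proof.
rewrite sum_cauchy_prod mulr_suml -sumrB; apply: eq_bigr => i _.
rewrite -mulrBr; congr (_ * _).
rewrite -!(big_mkord xpredT b) (@big_cat_nat _ _ _ (N - i)%N 0 N)//= ?leq_subr//.
by rewrite addrAC subrr add0r.
Qed.

End Conv.

Notation psum u := (fun N : nat => \sum_(i < N) u i).

Lemma eq_psum (V : nmodType) (x y : nat -> V) : x =1 y -> psum x = psum y.
Proof. by move=> xy; apply/funext => N; apply: eq_bigr => i _. Qed.

(** * Convergence of series and of their Cauchy products *)

Section Convergence.
Variable R : realType.

Lemma psum_nd (x : nat -> R) : (forall n, 0 <= x n) ->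
  {homo psum x : n m / (n <= m)%N >-> n <= m}.
Proof.
by move=> x0; apply/nondecreasing_seqP => n; rewrite big_ord_recr /= lerDl.
Qed.

Lemma psum_le (x : nat -> R) (X : R) : (forall n, 0 <= x n) ->
  psum x @ \oo --> X -> forall N, \sum_(i < N) x i <= X.
Proof.
move=> x0 cx N; rewrite -(cvg_lim (@Rhausdorff R) cx).
apply: (nondecreasing_cvgn_le (psum_nd x0)).
exact: (cvgP _ cx).
Qed.

Lemma psum_bounded (x : nat -> R) M : (forall n, 0 <= x n) ->
  (forall N, \sum_(i < N) x i <= M) ->
  exists2 X, psum x @ \oo --> X & X <= M.
Proof.
move=> x0 xM.
have cx : cvgn (psum x).
  apply: (nondecreasing_is_cvgn (psum_nd x0)).
  by exists M => _ [n _ <-].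
exists (limn (psum x)) => //.
by apply: limr_le => //; apply: nearW.
Qed.

Lemma cvg0_bounded (e : nat -> R) (l : R) : e @ \oo --> l ->
  exists M, forall n, `|e n| <= M.
Proof.
move=> ce; have [M [_ hM]] := cvg_seq_bounded (cvgP _ ce).
by exists (M + 1) => n; apply: hM => //; rewrite ltrDl.
Qed.

Lemma cvg0_le (e u : nat -> R) : (forall n, 0 <= u n <= e n) ->
  e @ \oo --> (0 : R) -> u @ \oo --> (0 : R).
Proof.
move=> h ce; apply: (squeeze_cvgr (f := fun=> 0) (h := e)) => //.
  exact: nearW.
exact: cvg_cst.
Qed.

(** With nonnegative terms, the triangle of pairs [i + j < N] contributes at most [X * Y], while the
    square of side [n] fits into the triangle [i + j < n + n], which gives the reverse inequality in
    the limit. *)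
Lemma cauchy_prod_cvg_ge0 (x y : nat -> R) (X Y : R) :
  (forall n, 0 <= x n) -> (forall n, 0 <= y n) ->
  psum x @ \oo --> X -> psum y @ \oo --> Y ->
  psum (cauchy_prod x y) @ \oo --> X * Y.
Proof.
move=> x0 y0 cx cy.
have xy0 n : 0 <= cauchy_prod x y n by apply: sumr_ge0 => i _; rewrite mulr_ge0.
have X0 : 0 <= X by have := psum_le x0 cx 0; rewrite big_ord0.
have [|L cL LXY] := @psum_bounded (cauchy_prod x y) (X * Y) xy0.
  move=> N; rewrite sum_cauchy_prod; apply: le_trans (_ : (\sum_(i < N) x i) * Y <= _).
    rewrite mulr_suml; apply: ler_sum => i _; rewrite ler_wpM2l//.
    exact: psum_le.
  rewrite ler_wpM2r//; last exact: psum_le.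
  by have := psum_le y0 cy 0; rewrite big_ord0.
suff -> : X * Y = L by [].
apply/eqP; rewrite eq_le LXY andbT.
have cXY : (fun n => (\sum_(i < n) x i) * (\sum_(i < n) y i)) @ \oo --> X * Y.
  exact: cvgM.
rewrite -(cvg_lim (@Rhausdorff R) cXY); apply: limr_le; first exact: (cvgP _ cXY).
apply: nearW => n; apply: le_trans (psum_le xy0 cL (n + n)).
rewrite sum_cauchy_prod big_split_ord /= -[leLHS]addr0 lerD//; last first.
  by apply: sumr_ge0 => i _; rewrite mulr_ge0// sumr_ge0.
rewrite mulr_suml; apply: ler_sum => i _; rewrite ler_wpM2l//.
by apply: (psum_nd y0); rewrite -addnBA ?leq_addr// ltnW.
Qed.

(** Convergence in [R[i]] is measured by the real modulus, the form in which [analytic_on_disc]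
    states it. *)
Definition csum (a : nat -> R[i]) (s : R[i]) :=
  (fun n => cmod (s - \sum_(m < n) a m)) @ \oo --> (0 : R).

(** The error splits into [s * (t - T) + (s - S) * T] and the gap between [S * T] and the partial
    sum of the Cauchy product. That gap is dominated by the same gap for the moduli, which tends to
    [A * B - A * B]. *)
Lemma csum_cauchy_prod (a b : nat -> R[i]) s t :
  cvgn (psum (fun n => cmod (a n))) -> cvgn (psum (fun n => cmod (b n))) ->
  csum a s -> csum b t -> csum (cauchy_prod a b) (s * t).
Proof.
move=> /cvg_ex[/= A ca] /cvg_ex[/= B cb] sa tb.
have ab0 := cauchy_prod_cvg_ge0 (fun n => cmod_ge0 (a n)) (fun n => cmod_ge0 (b n)) ca cb.
pose e1 n := cmod (s - \sum_(m < n) a m).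
pose e2 n := cmod (t - \sum_(m < n) b m).
pose e3 n := (\sum_(i < n) cmod (a i)) * (\sum_(i < n) cmod (b i)) -
  \sum_(i < n) cauchy_prod (fun n => cmod (a n)) (fun n => cmod (b n)) i.
apply: (@cvg0_le (fun n => cmod s * e2 n + e1 n * (cmod t + e2 n) + e3 n)).
  move=> n; rewrite cmod_ge0/=.
  set S := \sum_(i < n) a i; set T := \sum_(i < n) b i.
  rewrite (_ : s * t - _ = s * (t - T) + (s - S) * T +
      (S * T - \sum_(i < n) cauchy_prod a b i)); last by ring.
  apply: le_trans (cmodD _ _) _; apply: lerD; last first.
    rewrite /e3 !prod_sum_sub_cauchy_prod; apply: le_trans (cmod_sum _ _ _) _.
    by apply: ler_sum => i _; rewrite cmodM ler_wpM2l ?cmod_ge0// cmod_sum.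
  apply: le_trans (cmodD _ _) _; rewrite !cmodM; apply: lerD => //.
  rewrite ler_wpM2l ?cmod_ge0// /e2 -/T.
  by rewrite -{1}(subrK t T) (cmod_sub t) addrC cmodD.
rewrite (_ : 0 = cmod s * 0 + 0 * (cmod t + 0) + (A * B - A * B)); last by ring.
apply: cvgD; last by apply: cvgB => //; exact: cvgM.
apply: cvgD; first by apply: cvgM => //; exact: cvg_cst.
by apply: cvgM => //; apply: cvgD => //; exact: cvg_cst.
Qed.

Lemma csum_terms_bounded (a : nat -> R[i]) s : csum a s ->
  exists M, forall n, cmod (a n) <= M.
Proof.
move=> /cvg0_bounded[M hM]; exists (M + M) => n.
rewrite (_ : a n = (s - \sum_(m < n) a m) - (s - \sum_(m < n.+1) a m)).
  apply: le_trans (cmodD _ _) _; rewrite cmodN.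
  by apply: lerD; apply: le_trans (ler_norm _) (hM _).
by rewrite big_ord_recr /=; ring.
Qed.

(** Abel's argument: at a radius [s] strictly between [rho] and [r] the terms are bounded, so at
    [rho] they are dominated by a geometric series of ratio [rho / s]. *)
Lemma power_series_abs_cvg (c : nat -> R[i]) (r : R) :
  (forall z, cmod z < r -> exists s, csum (fun n => c n * z ^+ n) s) ->
  forall rho, 0 <= rho < r -> cvgn (psum (fun n => cmod (c n) * rho ^+ n)).
Proof.
move=> h rho /andP[rho0 rhor].
pose s := (rho + r) / 2.
have rhos : rho < s by rewrite /s; lra.
have s0 : 0 < s by rewrite (le_lt_trans rho0).
have [t] : exists t, csum (fun n => c n * (s%:C) ^+ n) t.
  by apply: h; rewrite cmodC gtr0_norm// /s; lra.
move=> /csum_terms_bounded[M hM].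
have q1 : `|rho / s| < 1.
  by rewrite ger0_norm ?ltr_pdivrMr ?mul1r// divr_ge0// ltW.
have q0 : 0 <= rho / s by apply: divr_ge0 => //; exact: ltW.
have := is_cvg_geometric_series (a := M) q1.
rewrite !seriesEord => hg.
suff : cvgn (series (fun n => cmod (c n) * rho ^+ n)) by rewrite seriesEord.
apply: (@series_le_cvg _ _ (geometric M (rho / s))).
- by move=> n; rewrite mulr_ge0 ?cmod_ge0 ?exprn_ge0.
- move=> n /=; rewrite mulr_ge0 ?exprn_ge0//.
  exact: le_trans (cmod_ge0 _) (hM 0%N).
- move=> n /=; rewrite expr_div_n mulrA mulrAC ler_wpM2r ?exprn_ge0//.
  rewrite ler_pdivlMr ?exprn_gt0//.
  by have := hM n; rewrite cmodM cmodX cmodC gtr0_norm.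
- by rewrite seriesEord.
Qed.

Lemma csum_cauchy_prod_powers (a b : nat -> R[i]) (r : R) z s t :
  (forall z, cmod z < r -> exists s, csum (fun n => a n * z ^+ n) s) ->
  (forall z, cmod z < r -> exists s, csum (fun n => b n * z ^+ n) s) ->
  cmod z < r -> csum (fun n => a n * z ^+ n) s ->
  csum (fun n => b n * z ^+ n) t -> csum (fun n => cauchy_prod a b n * z ^+ n) (s * t).
Proof.
move=> ha hb zr hs ht.
have -> : (fun n => cauchy_prod a b n * z ^+ n) =
    cauchy_prod (fun n => a n * z ^+ n) (fun n => b n * z ^+ n).
  apply/funext => n; rewrite /cauchy_prod mulr_suml; apply: eq_bigr => i _.
  have -> : z ^+ n = z ^+ i * z ^+ (n - i) by rewrite -exprD subnKC// -ltnS.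
  by ring.
have abs (c : nat -> R[i]) :
    (forall z, cmod z < r -> exists s, csum (fun n => c n * z ^+ n) s) ->
    cvgn (psum (fun n => cmod (c n * z ^+ n))).
  move=> /power_series_abs_cvg/(_ (cmod z)); rewrite cmod_ge0 zr => /(_ isT).
  by under [in X in _ -> X]eq_fun do under eq_bigr do rewrite cmodM cmodX.
by apply: csum_cauchy_prod => //; exact: abs.
Qed.

End Convergence.

(** * The inequality for coefficient sequences *)

Section Binomial.
Variable R : realType.
Implicit Types (al be : R) (n : nat).

(* The coefficient of [z ^+ n] in [(1 - z) ^ (- al)]. *)
Definition cbin al n : R := \prod_(i < n) ((al + i%:R) / i.+1%:R).

Lemma cbin0 al : cbin al 0 = 1. Proof. exact: big_ord0. Qed.

Lemma cbinS al n : n.+1%:R * cbin al n.+1 = (al + n%:R) * cbin al n.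
Proof.
rewrite /cbin big_ord_recr /= mulrCA mulrC; congr (_ * _).
by rewrite mulrC divfK// pnatr_eq0.
Qed.

Lemma cbin_gt0 al n : 0 < al -> 0 < cbin al n.
Proof. by move=> a0; apply: prodr_gt0 => i _; rewrite divr_gt0// ltr_wpDr. Qed.

Lemma cbin_ge1 al n : 1 <= al -> 1 <= cbin al n.
Proof.
move=> a1; elim: n => [|n ih]; first by rewrite cbin0.
have := cbinS al n; have : 0 <= (al - 1) * cbin al n.
  by rewrite mulr_ge0 ?subr_ge0// (le_trans ler01).
have := ler0n R n; have : n.+1%:R = n%:R + 1 :> R by rewrite -natr1.
by move=> -> *; nra.
Qed.

Lemma cbin1 n : cbin 1 n = 1.
Proof. by apply: big1 => i _; rewrite nat1r divff// pnatr_eq0. Qed.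

(** Splitting [n.+1] as [i + (n.+1 - i)] lets the recurrence [cbinS] act on either factor; this is
    the product rule for [(1 - z) y' = al y] read on coefficients. *)
Lemma cbin_vandermonde al be :
  cauchy_prod (cbin al) (cbin be) = cbin (al + be).
Proof.
apply/funext; elim => [|n ih].
  by rewrite /cauchy_prod big_ord1 !cbin0 mulr1.
apply: (@mulfI _ n.+1%:R); first by rewrite pnatr_eq0.
rewrite cbinS -ih /cauchy_prod.
transitivity (\sum_(i < n.+2) i%:R * cbin al i * cbin be (n.+1 - i) +
    \sum_(i < n.+2) cbin al i * ((n.+1 - i)%:R * cbin be (n.+1 - i))).
  rewrite -big_split mulr_sumr; apply: eq_bigr => i _ /=.
  rewrite [in X in X * _ = _](_ : n.+1 = i + (n.+1 - i))%N ?natrD; first by ring.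
  by rewrite subnKC// -ltnS.
rewrite big_ord_recl [X in _ + X]big_ord_recr /= subnn !mul0r mulr0 add0r addr0.
rewrite -big_split mulr_sumr; apply: eq_bigr => i _ /=.
have lein : (i <= n)%N by rewrite -ltnS.
rewrite [bump 0 i]add1n subSS subSn// !cbinS (_ : n%:R = i%:R + (n - i)%:R); first by ring.
by rewrite -natrD subnKC.
Qed.

End Binomial.

Section Lagrange.
Variable R : realType.

Lemma lagrange_identity n (w p : 'I_n -> R) :
  (\sum_i w i) * (\sum_i w i * p i ^+ 2) - (\sum_i w i * p i) ^+ 2 =
  2^-1 * \sum_i \sum_j w i * w j * (p i - p j) ^+ 2.
Proof.
have D (f g : 'I_n -> R) :
    (\sum_i f i) * (\sum_i g i) = \sum_i \sum_j f i * g j.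
  by rewrite big_distrl; apply: eq_bigr => i _; rewrite big_distrr.
(* The product is written as the half-sum of its two orders, so that the double sum becomes
   symmetric in [i] and [j] like the square on the right. *)
rewrite (_ : (\sum_i w i) * _ =
  2^-1 * ((\sum_i w i) * (\sum_i w i * p i ^+ 2) +
          (\sum_i w i * p i ^+ 2) * (\sum_i w i))); last by field.
rewrite expr2 !D -big_split -sumrN !mulr_sumr -big_split; apply: eq_bigr => i _ /=.
rewrite -big_split -sumrN !mulr_sumr -big_split; apply: eq_bigr => j _ /=.
by field.
Qed.

Lemma lagrange_identity_complex n (w : 'I_n -> R) (v : 'I_n -> R[i]) :
  (\sum_i w i) * (\sum_i w i * cmod (v i) ^+ 2) -
    cmod (\sum_i (w i)%:C * v i) ^+ 2 =
  2^-1 * \sum_i \sum_j w i * w j * cmod (v i - v j) ^+ 2.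
Proof.
rewrite sqr_cmod !raddf_sum /=.
have -> : \sum_i complex.Re ((w i)%:C * v i) = \sum_i w i * complex.Re (v i).
  by apply: eq_bigr => i _; case: (v i) => x y; simpc.
have -> : \sum_i complex.Im ((w i)%:C * v i) = \sum_i w i * complex.Im (v i).
  by apply: eq_bigr => i _; case: (v i) => x y; simpc.
have -> : \sum_i w i * cmod (v i) ^+ 2 =
    \sum_i w i * complex.Re (v i) ^+ 2 + \sum_i w i * complex.Im (v i) ^+ 2.
  by rewrite -big_split; apply: eq_bigr => i _; rewrite sqr_cmod mulrDr.
rewrite mulrDr opprD addrACA !lagrange_identity -mulrDr -big_split.
congr (_ * _); apply: eq_bigr => i _; rewrite -big_split /=.
apply: eq_bigr => j _; rewrite sqr_cmod -mulrDr.
by case: (v i) (v j) => x y [x' y'].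
Qed.

End Lagrange.

Section WeightedNorm.
Variable R : realType.
Implicit Types (al be : R) (a b : nat -> R[i]) (X Y Z : R).

Definition wsq al a n : R := cmod (a n) ^+ 2 / cbin al n.

Definition sqnorm al a X := psum (wsq al a) @ \oo --> X.

(** The Taylor coefficients of [lam * (1 - w z) ^ (- al)], the candidate extremal function. *)
Definition geo al (lam w : R[i]) n : R[i] := lam * (cbin al n)%:C * w ^+ n.

Lemma wsq_ge0 al a n : 0 < al -> 0 <= wsq al a n.
Proof. by move=> a0; rewrite divr_ge0 ?sqr_ge0// ltW// cbin_gt0. Qed.

Lemma sqnorm_gt0 al a X n : 0 < al -> sqnorm al a X -> a n != 0 -> 0 < X.
Proof.
move=> al0 aX an0; have wa0 m : 0 <= wsq al a m by exact: wsq_ge0.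
apply: lt_le_trans (psum_le wa0 aX n.+1); rewrite big_ord_recr /=.
rewrite ltr_wpDl ?sumr_ge0//.
by rewrite divr_gt0 ?cbin_gt0// exprn_gt0// lt_def cmod_eq0 an0 cmod_ge0.
Qed.

Lemma sqnorm_ge0 al a X : 0 < al -> sqnorm al a X -> 0 <= X.
Proof.
move=> al0 aX; have := psum_le (fun m => wsq_ge0 a m al0) aX 0.
by rewrite big_ord0.
Qed.

Lemma sqnorm_neq0 al a X : sqnorm al a X -> X != 0 -> exists n, a n != 0.
Proof.
move=> aX X0; have [//|/forallNP a0] := pselect (exists n, a n != 0).
have /eqP[] := X0.
suff : sqnorm al a 0 by exact: cvg_unique aX.
rewrite /sqnorm (_ : psum (wsq al a) = fun=> 0); first exact: cvg_cst.
apply/funext => N; apply: big1 => i _; rewrite /wsq.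
by have /negP/negPn/eqP -> := a0 i; rewrite cmod0 expr0n mul0r.
Qed.

Lemma cauchy_prod_geo al be lam mu w :
  cauchy_prod (geo al lam w) (geo be mu w) = geo (al + be) (lam * mu) w.
Proof.
apply/funext => n; rewrite /geo -cbin_vandermonde /cauchy_prod rmorph_sum /=.
rewrite mulr_sumr mulr_suml; apply: eq_bigr => i _; rewrite rmorphM /=.
have -> : w ^+ n = w ^+ i * w ^+ (n - i) by rewrite -exprD subnKC// -ltnS.
by ring.
Qed.

(** The loss in the weighted Cauchy-Schwarz bound for the coefficient of index [N], normalized by
    the total weight [cbin (al + be) N]. *)
Definition defect al be a b N : R :=
  cauchy_prod (wsq al a) (wsq be b) N - wsq (al + be) (cauchy_prod a b) N.

(** Lagrange's identity with weights [cbin al i * cbin be (N - i)], whose total is the factor on the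
    left by Vandermonde. *)
Lemma defectE al be a b N : 0 < al -> 0 < be ->
  cbin (al + be) N * defect al be a b N = 2^-1 * \sum_(i < N.+1) \sum_(j < N.+1)
    (cbin al i * cbin be (N - i)) * (cbin al j * cbin be (N - j)) *
    cmod (a i / (cbin al i)%:C * (b (N - i)%N / (cbin be (N - i))%:C) -
          a j / (cbin al j)%:C * (b (N - j)%N / (cbin be (N - j))%:C)) ^+ 2.
Proof.
move=> al0 be0.
have ca n : cbin al n != 0 by rewrite gt_eqF// cbin_gt0.
have cb n : cbin be n != 0 by rewrite gt_eqF// cbin_gt0.
have caC n : (cbin al n)%:C != 0 :> R[i] by rewrite fmorph_eq0.
have cbC n : (cbin be n)%:C != 0 :> R[i] by rewrite fmorph_eq0.
rewrite -(lagrange_identity_complex (fun i : 'I_N.+1 => cbin al i * cbin be (N - i))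
  (fun i : 'I_N.+1 => a i / (cbin al i)%:C * (b (N - i)%N / (cbin be (N - i))%:C))).
rewrite /defect mulrBr; congr (_ - _); last first.
  rewrite /wsq mulrCA divff ?mulr1; last by rewrite gt_eqF// cbin_gt0// addr_gt0.
  congr (cmod _ ^+ 2); apply: eq_bigr => i _; rewrite rmorphM /=.
  by field; rewrite caC cbC.
rewrite -cbin_vandermonde; congr (_ * _); apply: eq_bigr => i _.
rewrite /wsq !cmodM !cmodV !cmodC !gtr0_norm ?cbin_gt0//.
by field; rewrite ca cb.
Qed.

Lemma defect_ge0 al be a b N : 0 < al -> 0 < be -> 0 <= defect al be a b N.
Proof.
move=> al0 be0; have c0 := @cbin_gt0 R (al + be) N (addr_gt0 al0 be0).
rewrite -(pmulr_rge0 _ c0) defectE// mulr_ge0// ?invr_ge0//.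
apply: sumr_ge0 => i _; apply: sumr_ge0 => j _.
by rewrite !mulr_ge0 ?exprn_ge0 ?cmod_ge0// ltW// cbin_gt0.
Qed.

Lemma defect_eq0 al be a b N : 0 < al -> 0 < be -> defect al be a b N = 0 ->
  forall i j : 'I_N.+1,
    a i / (cbin al i)%:C * (b (N - i)%N / (cbin be (N - i))%:C) =
    a j / (cbin al j)%:C * (b (N - j)%N / (cbin be (N - j))%:C).
Proof.
move=> al0 be0 d0 i j; have := defectE a b N al0 be0; rewrite d0 mulr0 => /esym/eqP.
have c0 n : 0 < cbin al n by exact: cbin_gt0.
have c1 n : 0 < cbin be n by exact: cbin_gt0.
rewrite mulf_eq0 invr_eq0 pnatr_eq0 /= psumr_eq0 => [|i' _]; last first.
  by apply: sumr_ge0 => j' _; rewrite !mulr_ge0 ?exprn_ge0 ?cmod_ge0// ltW.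
move=> /allP/(_ i (mem_index_enum _)) /=.
rewrite psumr_eq0 => [|j' _]; last by rewrite !mulr_ge0 ?exprn_ge0 ?cmod_ge0// ltW.
move=> /allP/(_ j (mem_index_enum _)) /=.
rewrite !mulf_eq0 !(gt_eqF (c0 _)) !(gt_eqF (c1 _)) /= orbb.
by rewrite cmod_eq0 subr_eq0 => /eqP.
Qed.

Lemma defect_geo al be lam mu w N : 0 < al -> 0 < be ->
  defect al be (geo al lam w) (geo be mu w) N = 0.
Proof.
move=> al0 be0; have c0 := @cbin_gt0 R (al + be) N (addr_gt0 al0 be0).
apply: (mulfI (lt0r_neq0 c0)); rewrite defectE// mulr0 big1 ?mulr0// => i _.
have E (k : 'I_N.+1) : geo al lam w k / (cbin al k)%:C *
    (geo be mu w (N - k) / (cbin be (N - k))%:C) = lam * mu * w ^+ N.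
  have -> : w ^+ N = w ^+ k * w ^+ (N - k) by rewrite -exprD subnKC// -ltnS.
  by rewrite /geo; field; rewrite !fmorph_eq0 !gt_eqF// cbin_gt0.
by apply: big1 => j _; rewrite !E subrr cmod0 expr0n mulr0.
Qed.

(** The Cauchy products of the two weighted sequences sum to exactly [X * Y], so the product has
    squared norm [X * Y - D] with [D] the sum of the defects. These being nonnegative, equality
    means that each of them vanishes. *)
Lemma sqnorm_cauchy_prod al be a b X Y : 0 < al -> 0 < be ->
  sqnorm al a X -> sqnorm be b Y ->
  exists Z, [/\ sqnorm (al + be) (cauchy_prod a b) Z, Z <= X * Y &
    Z = X * Y <-> forall N, defect al be a b N = 0].
Proof.
move=> al0 be0 aX bY; have albe0 := addr_gt0 al0 be0.
have cXY : psum (cauchy_prod (wsq al a) (wsq be b)) @ \oo --> X * Y.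
  by apply: cauchy_prod_cvg_ge0 => // n; exact: wsq_ge0.
have d0 N : 0 <= defect al be a b N by exact: defect_ge0.
have w0 N : 0 <= wsq al a N by exact: wsq_ge0.
have w1 N : 0 <= wsq be b N by exact: wsq_ge0.
have ww0 N : 0 <= wsq (al + be) (cauchy_prod a b) N by exact: wsq_ge0.
have xy0 N : 0 <= cauchy_prod (wsq al a) (wsq be b) N.
  by apply: sumr_ge0 => i _; rewrite mulr_ge0.
have [|D cD DXY] := @psum_bounded _ (defect al be a b) (X * Y) d0.
  move=> N; apply: le_trans (psum_le xy0 cXY N); apply: ler_sum => i _.
  by rewrite /defect gerBl.
exists (X * Y - D); split; last 2 first.
- by rewrite gerBl; have := psum_le d0 cD 0; rewrite big_ord0.
- split=> [|h].
    move=> /eqP; rewrite subr_eq -subr_eq0 opprD addNKr oppr_eq0 => /eqP D0 N.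
    apply/eqP; rewrite eq_le d0 andbT -D0; apply: le_trans (psum_le d0 cD N.+1).
    by rewrite big_ord_recr /= lerDr sumr_ge0.
  have : psum (defect al be a b) @ \oo --> (0 : R).
    rewrite (_ : psum (defect al be a b) = fun=> 0); first exact: cvg_cst.
    by apply/funext => N; exact: big1.
  move=> c0; have -> : D = 0 by exact: (cvg_unique _ cD c0).
  exact: subr0.
rewrite /sqnorm (_ : psum (wsq (al + be) (cauchy_prod a b)) = (fun N => \sum_(i < N) cauchy_prod (wsq al a) (wsq be b) i -
  \sum_(i < N) defect al be a b i)); first exact: cvgB.
by apply/funext => N; rewrite -sumrB; apply: eq_bigr => i _; rewrite /defect; ring.
Qed.

(** A zero of [x] at index 0 would propagate along [x] through a nonzero entry of [y]; a zero of [y]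
    at index 0 would then propagate along [y] through [x 0]. Hence the ratio [x 1 / x 0] makes
    sense, and it governs both sequences. *)
Lemma geometric_of_hankel (x y : nat -> R[i]) :
  (forall m n, x m * y n.+1 = x m.+1 * y n) ->
  (exists n, x n != 0) -> (exists n, y n != 0) ->
  exists w, [/\ x 0%N != 0, y 0%N != 0, forall n, x n = x 0%N * w ^+ n &
    forall n, y n = y 0%N * w ^+ n].
Proof.
move=> h ex ey.
have x0 : x 0%N != 0.
  apply/negP => /eqP x0; have [n yn] := ey.
  have [m xm] := ex; move/eqP: xm; apply; elim: m => // m ih.
  by apply: (mulIf yn); rewrite -h ih !mul0r.
have y0 : y 0%N != 0.
  apply/negP => /eqP y0; have [n yn] := ey.
  move/eqP: yn; apply; elim: n => // n ih.
  by apply: (mulfI x0); rewrite h ih !mulr0.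
exists (x 1%N / x 0%N); split => //; elim => [|n ih]; rewrite ?expr0 ?mulr1//.
  apply: (mulIf y0); rewrite -h -[y 1%N](mulKf x0) h ih exprSr.
  by field.
apply: (mulfI x0); rewrite h ih exprS.
by field.
Qed.

Lemma defect_eq0_geo al be a b : 0 < al -> 0 < be ->
  (forall N, defect al be a b N = 0) ->
  (exists n, a n != 0) -> (exists n, b n != 0) ->
  exists lam mu w, [/\ lam != 0, mu != 0, a = geo al lam w & b = geo be mu w].
Proof.
move=> al0 be0 d0 ea eb.
have caC n : (cbin al n)%:C != 0 :> R[i] by rewrite fmorph_eq0 gt_eqF// cbin_gt0.
have cbC n : (cbin be n)%:C != 0 :> R[i] by rewrite fmorph_eq0 gt_eqF// cbin_gt0.
pose x n := a n / (cbin al n)%:C; pose y n := b n / (cbin be n)%:C.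
have aE n : a n = x n * (cbin al n)%:C by rewrite /x divfK.
have bE n : b n = y n * (cbin be n)%:C by rewrite /y divfK.
have [m n|||w [x0 y0 xE yE]] := @geometric_of_hankel x y.
(* The entries of index [m] and [m.+1] are compared on the antidiagonal [m + n + 1]. *)
- have mN : (m < (m + n).+2)%N by rewrite ltnS leqW// leq_addr.
  have m1N : (m.+1 < (m + n).+2)%N by rewrite !ltnS leq_addr.
  have := defect_eq0 al0 be0 (d0 (m + n).+1) (Ordinal mN) (Ordinal m1N).
  by rewrite /= -addnS addKn addnS -addSn addKn.
- by have [n an] := ea; exists n; apply: contra an; rewrite aE => /eqP ->; rewrite mul0r.
- by have [n bn] := eb; exists n; apply: contra bn; rewrite bE => /eqP ->; rewrite mul0r.
exists (x 0%N), (y 0%N), w; split => //; apply/funext => n.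
  by rewrite aE xE /geo mulrAC.
by rewrite bE yE /geo mulrAC.
Qed.

(** The coefficients of index 0 and 1 already determine the factor and the ratio. *)
Lemma geo_inj al lam mu v w : 0 < al -> lam != 0 ->
  geo al lam v = geo al mu w -> v = w.
Proof.
move=> al0 lam0 e; have := congr1 (@^~ 0%N) e; have := congr1 (@^~ 1%N) e.
rewrite /= /geo cbin0 !expr0 !expr1 !mulr1 => + lm; rewrite -lm; apply: mulfI.
by rewrite mulf_neq0// fmorph_eq0 gt_eqF// cbin_gt0.
Qed.

(** If [1 <= cmod w], every term of the norm is at least [cmod lam ^+ 2], because [1 <= al] makes
    [cbin al n] at least 1; the sum would then exceed [X]. *)
Lemma geo_ratio_lt1 al lam w X : 1 <= al -> lam != 0 ->
  sqnorm al (geo al lam w) X -> cmod w < 1.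
Proof.
move=> al1 lam0 aX; rewrite ltNge; apply/negP => w1.
have al0 : 0 < al by rewrite (lt_le_trans ltr01).
have l0 : 0 < cmod lam ^+ 2 by rewrite exprn_gt0// lt_def cmod_eq0 lam0 cmod_ge0.
have t n : cmod lam ^+ 2 <= wsq al (geo al lam w) n.
  rewrite /wsq /geo !cmodM cmodX cmodC gtr0_norm ?cbin_gt0//.
  have c0 := cbin_gt0 n al0; rewrite ler_pdivlMr//.
  rewrite (_ : (_ * _ * _) ^+ 2 =
    cmod lam ^+ 2 * (cbin al n * (cbin al n * (cmod w ^+ n) ^+ 2))); last by ring.
  rewrite ler_wpM2l ?(ltW l0)// ler_peMr ?(ltW c0)//.
  by rewrite mulr_ege1 ?cbin_ge1// !exprn_ege1.
have X0 := sqnorm_ge0 al0 aX.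
have /archi_boundP := divr_ge0 X0 (ltW l0).
rewrite ltr_pdivrMr// ltNge => /negP; apply.
apply: le_trans (psum_le (fun m => wsq_ge0 _ m al0) aX (Num.bound (X / cmod lam ^+ 2))).
rewrite mulr_natl -[X in _ *+ X]card_ord -sumr_const.
by apply: ler_sum => i _; exact: t.
Qed.

End WeightedNorm.

(** * Several factors and their equality case *)

Section Products.
Variable R : realType.
Implicit Types (al be : R) (X Y Z : R).

(** Nested to the right, so that it unfolds at [ord0]; [unit_seq] ends the nesting and is removed by
    [cauchy_prod_unit]. *)
Definition cauchy_bigprod k (a : 'I_k -> nat -> R[i]) : nat -> R[i] :=
  \big[@cauchy_prod R[i] / @unit_seq R[i]]_(j < k) a j.

Lemma cauchy_bigprod1 (a : 'I_1 -> nat -> R[i]) : cauchy_bigprod a = a ord0.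
Proof. by rewrite /cauchy_bigprod big_ord_recl big_ord0 cauchy_prod_unit. Qed.

Lemma cauchy_bigprodS k (a : 'I_k.+1 -> nat -> R[i]) :
  cauchy_bigprod a = cauchy_prod (a ord0) (cauchy_bigprod (a \o lift ord0)).
Proof. exact: big_ord_recl. Qed.

(** The induction starts at one factor: an empty product would have exponent 0, where the weights
    [cbin 0 n] vanish for positive [n]. *)
Lemma sqnorm_bigprod k (a : 'I_k.+1 -> nat -> R[i]) (al X : 'I_k.+1 -> R) :
  (forall j, 0 < al j) -> (forall j, sqnorm (al j) (a j) (X j)) ->
  exists2 Z, sqnorm (\sum_j al j) (cauchy_bigprod a) Z & Z <= \prod_j X j.
Proof.
elim: k a al X => [|k ih] a al X al0 aX.
  by exists (X ord0); rewrite ?cauchy_bigprod1 !big_ord1//; exact: aX.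
have [Z cZ leZ] := ih (a \o lift ord0) _ _ (fun j => al0 (lift ord0 j))
  (fun j => aX (lift ord0 j)).
have be0 : 0 < \sum_j al (lift ord0 j).
  by rewrite big_ord_recl ltr_pwDl// sumr_ge0// => j _; exact: ltW.
have [Y [cY leY _]] := sqnorm_cauchy_prod (al0 ord0) be0 (aX ord0) cZ.
exists Y; first by rewrite cauchy_bigprodS big_ord_recl.
rewrite big_ord_recl; apply: le_trans leY _; rewrite ler_wpM2l//.
exact: sqnorm_ge0 (aX ord0).
Qed.

Lemma cauchy_bigprod_geo k (al : 'I_k.+1 -> R) (lam : 'I_k.+1 -> R[i]) w :
  cauchy_bigprod (fun j => geo (al j) (lam j) w) =
  geo (\sum_j al j) (\prod_j lam j) w.
Proof.
elim: k al lam => [|k ih] al lam; first by rewrite cauchy_bigprod1 !big_ord1.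
rewrite cauchy_bigprodS (ih (al \o lift ord0) (lam \o lift ord0)).
by rewrite cauchy_prod_geo !(big_ord_recl k.+1).
Qed.

Lemma sqnorm_bigprod_geo k (al X : 'I_k.+1 -> R) (lam : 'I_k.+1 -> R[i]) w :
  (forall j, 0 < al j) ->
  (forall j, sqnorm (al j) (geo (al j) (lam j) w) (X j)) ->
  sqnorm (\sum_j al j) (geo (\sum_j al j) (\prod_j lam j) w) (\prod_j X j).
Proof.
elim: k al lam X => [|k ih] al lam X al0 aX; first by rewrite !big_ord1.
have := ih _ _ _ (fun j => al0 (lift ord0 j)) (fun j => aX (lift ord0 j)).
have be0 : 0 < \sum_j al (lift ord0 j).
  by rewrite big_ord_recl ltr_pwDl// sumr_ge0// => j _; exact: ltW.
move=> /(sqnorm_cauchy_prod (al0 ord0) be0 (aX ord0))[Z [cZ _ [_ ZE]]].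
rewrite !(big_ord_recl k.+1) -cauchy_prod_geo -ZE// => N.
exact: defect_geo.
Qed.

(** Equality for all factors forces equality for the tail, since [X ord0] is positive and can be
    cancelled. The tail product is then nonzero because its norm is, and the equality case for two
    factors applies to the head and the tail. *)
Lemma sqnorm_bigprod_eq_split k (a : 'I_k.+2 -> nat -> R[i])
    (al X : 'I_k.+2 -> R) :
  (forall j, 0 < al j) -> (forall j, exists n, a j n != 0) ->
  (forall j, sqnorm (al j) (a j) (X j)) ->
  sqnorm (\sum_j al j) (cauchy_bigprod a) (\prod_j X j) ->
  exists lam nu w, [/\ lam != 0, nu != 0, a ord0 = geo (al ord0) lam w,
    cauchy_bigprod (a \o lift ord0) = geo (\sum_j al (lift ord0 j)) nu w &
    sqnorm (\sum_j al (lift ord0 j)) (cauchy_bigprod (a \o lift ord0))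
      (\prod_j X (lift ord0 j))].
Proof.
move=> al0 an0 aX.
have be0 : 0 < \sum_j al (lift ord0 j).
  by rewrite big_ord_recl ltr_pwDl// sumr_ge0// => j _; exact: ltW.
have [Z cZ leZ] := sqnorm_bigprod (fun j => al0 (lift ord0 j))
  (fun j => aX (lift ord0 j)).
have [Y [cY leY YE]] := sqnorm_cauchy_prod (al0 ord0) be0 (aX ord0) cZ.
have X0 : 0 < X ord0 by have [n] := an0 ord0; exact: sqnorm_gt0.
rewrite cauchy_bigprodS !(big_ord_recl k.+1) /= => cX.
have YX : Y = X ord0 * \prod_j X (lift ord0 j) by exact: (cvg_unique _ cY cX).
have ZX : Z = \prod_j X (lift ord0 j).
  by apply/eqP; rewrite eq_le leZ/= -(ler_pM2l X0) -YX.
have bn0 : exists n, cauchy_bigprod (a \o lift ord0) n != 0.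
  apply: (sqnorm_neq0 cZ); rewrite ZX gt_eqF// prodr_gt0// => j _.
  by have [n] := an0 (lift ord0 j); exact: sqnorm_gt0.
have d0 : forall N, defect (al ord0) (\sum_j al (lift ord0 j)) (a ord0)
    (cauchy_bigprod (a \o lift ord0)) N = 0.
  by apply/YE; rewrite YX ZX.
have [lam [nu [w [lam0 nu0 a0E bE]]]] :=
  defect_eq0_geo (al0 ord0) be0 d0 (an0 ord0) bn0.
by exists lam, nu, w; split => //; rewrite -ZX.
Qed.

(** The assumption on the product supplies the ratio at the last factor, where equality always
    holds. At each split, [geo_inj] identifies the new ratio with [w]. *)
Lemma sqnorm_bigprod_eq_geo k (a : 'I_k.+1 -> nat -> R[i]) (al X : 'I_k.+1 -> R)
    mu w :
  (forall j, 0 < al j) -> (forall j, exists n, a j n != 0) ->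
  (forall j, sqnorm (al j) (a j) (X j)) ->
  sqnorm (\sum_j al j) (cauchy_bigprod a) (\prod_j X j) ->
  mu != 0 -> cauchy_bigprod a = geo (\sum_j al j) mu w ->
  forall j, exists2 lam, lam != 0 & a j = geo (al j) lam w.
Proof.
elim: k a al X mu w => [|k ih] a al X mu w al0 an0 aX cX mu0 aE.
  move=> j; exists mu => //; move: aE; rewrite cauchy_bigprod1 big_ord1.
  by rewrite (ord1 j).
have [lam [nu [v [lam0 nu0 a0E bE cb]]]] := sqnorm_bigprod_eq_split al0 an0 aX cX.
have be0 : 0 < \sum_j al (lift ord0 j).
  by rewrite big_ord_recl ltr_pwDl// sumr_ge0// => j _; exact: ltW.
have vw : v = w.
  move: aE; rewrite cauchy_bigprodS a0E bE cauchy_prod_geo -big_ord_recl.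
  by apply: geo_inj; rewrite ?mulf_neq0// big_ord_recl addr_gt0.
subst v.
move=> j; case: (unliftP ord0 j) => [i ->|->]; last by exists lam.
by have := ih (a \o lift ord0) (al \o lift ord0) (X \o lift ord0) nu w
  (fun i => al0 (lift ord0 i)) (fun i => an0 (lift ord0 i))
  (fun i => aX (lift ord0 i)) cb nu0 bE i.
Qed.

Lemma sqnorm_bigprod_eq k (a : 'I_k.+2 -> nat -> R[i]) (al X : 'I_k.+2 -> R) :
  (forall j, 0 < al j) -> (forall j, exists n, a j n != 0) ->
  (forall j, sqnorm (al j) (a j) (X j)) ->
  sqnorm (\sum_j al j) (cauchy_bigprod a) (\prod_j X j) ->
  exists w, forall j, exists2 lam, lam != 0 & a j = geo (al j) lam w.
Proof.
move=> al0 an0 aX cX.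
have [lam [nu [w [lam0 nu0 a0E bE _]]]] := sqnorm_bigprod_eq_split al0 an0 aX cX.
exists w; apply: (@sqnorm_bigprod_eq_geo _ a al X (lam * nu) w) => //.
  by rewrite mulf_neq0.
by rewrite cauchy_bigprodS a0E bE cauchy_prod_geo (big_ord_recl k.+1).
Qed.

End Products.

(** * The binomial series *)

Section BinomialSeries.
Variable R : realType.
Implicit Types (al t : R) (z w : R[i]).

(** A factor [al + n] is traded for a raise of the exponent by one, which is how [n * cbin al n]
    gets controlled. *)
Lemma cbin_shift al n : al * cbin (al + 1) n = (al + n%:R) * cbin al n.
Proof.
elim: n => [|n ih]; first by rewrite !cbin0 addr0.
apply: (@mulfI _ n.+1%:R); first by rewrite pnatr_eq0.
rewrite [RHS]mulrCA cbinS [LHS]mulrCA cbinS mulrCA ih.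
by rewrite -(natr1 n); ring.
Qed.

Lemma cbin_le al be n : 0 <= al <= be -> cbin al n <= cbin be n.
Proof.
move=> /andP[a0 ab]; apply: ler_prod => i _.
by rewrite divr_ge0 ?addr_ge0//= ler_pM2r ?invr_gt0// lerD2r.
Qed.

(** For a positive integer exponent the series is an iterated Cauchy product of geometric series;
    real exponents are later compared with these. *)
Lemma cbin_power_cvg (m : nat) (rho : R) : 0 <= rho < 1 ->
  cvgn (psum (fun n => cbin m.+1%:R n * rho ^+ n)).
Proof.
move=> /andP[r0 r1]; have gE : (fun n => cbin 1 n * rho ^+ n) = geometric 1 rho.
  by apply/funext => n; rewrite cbin1.
have cg : cvgn (psum (fun n => cbin 1 n * rho ^+ n)).
  have : cvgn (series (geometric 1 rho)).
    by apply: is_cvg_geometric_series; rewrite ger0_norm.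
  by rewrite -gE seriesEord.
elim: m => [//|m ih].
have [/cvg_ex[/= A cA] /cvg_ex[/= B cB]] := (cg, ih).
have h k n : 0 < k -> 0 <= cbin k n * rho ^+ n.
  by move=> k0; rewrite mulr_ge0 ?exprn_ge0// ltW// cbin_gt0.
have := cauchy_prod_cvg_ge0 (fun n => h _ n ltr01) (fun n => h _ n (ltr0Sn _ m)) cA cB.
have -> : cauchy_prod (fun n => cbin 1 n * rho ^+ n) (fun n => cbin m.+1%:R n * rho ^+ n)
    = (fun n => cbin m.+2%:R n * rho ^+ n).
  apply/funext => n; rewrite -(nat1r m.+1) -cbin_vandermonde /cauchy_prod mulr_suml.
  apply: eq_bigr => i _.
  have -> : rho ^+ n = rho ^+ i * rho ^+ (n - i) by rewrite -exprD subnKC// -ltnS.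
  by ring.
by move=> cAB; apply/cvg_ex; exists (A * B).
Qed.

Lemma cbin_power_cvg0 al (rho : R) : 1 <= al -> 0 <= rho < 1 ->
  (fun n => n%:R * cbin al n * rho ^+ n) @ \oo --> (0 : R).
Proof.
move=> al1 rho01; have al0 : 0 <= al by rewrite (le_trans ler01).
(* [m.+1] is an integer exponent above [al + 1]; the extra 1 absorbs the factor [n] through
   [cbin_shift]. *)
pose m := Num.bound (al + 1).
have alm : al + 1 <= m.+1%:R.
  have /archi_boundP/ltW alm : 0 <= al + 1 by rewrite addr_ge0.
  by rewrite -natr1 ler_wpDr.
have : (fun n => al * (cbin m.+1%:R n * rho ^+ n)) @ \oo --> (0 : R).
  rewrite -[X in _ --> X](mulr0 al); apply: cvgM; first exact: cvg_cst.
  have := @cvg_series_cvg_0 _ R _ _; apply.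
  by rewrite seriesEord; exact: cbin_power_cvg.
apply: cvg0_le => n; have /andP[r0 _] := rho01.
have c0 : 0 <= cbin al n by rewrite (le_trans ler01)// cbin_ge1.
rewrite !mulr_ge0 ?exprn_ge0//= mulrA ler_wpM2r ?exprn_ge0//.
apply: (@le_trans _ _ (al * cbin (al + 1) n)); last first.
  by rewrite ler_wpM2l// cbin_le// addr_ge0//.
by rewrite cbin_shift ler_wpM2r// lerDr.
Qed.

Definition cderiv (F : R -> R[i]) (t : R) (D : R[i]) :=
  is_derive t 1 (fun s => complex.Re (F s)) (complex.Re D) /\
  is_derive t 1 (fun s => complex.Im (F s)) (complex.Im D).

Lemma cderiv_cst z t : cderiv (fun=> z) t 0.
Proof. by split; exact: is_derive_cst. Qed.

Lemma cderiv_scal z t : cderiv (fun s => s%:C * z) t z.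
Proof.
split.
  rewrite (_ : (fun s => _) = (fun s => s * complex.Re z)).
    by apply: is_derive_eq; rewrite /GRing.scale /= mulr0 add0r mulr1.
  by apply/funext => s; case: z => x y; simpc.
rewrite (_ : (fun s => _) = (fun s => s * complex.Im z)).
  by apply: is_derive_eq; rewrite /GRing.scale /= mulr0 add0r mulr1.
by apply/funext => s; case: z => x y; simpc.
Qed.

Lemma cderivD F G t D E : cderiv F t D -> cderiv G t E ->
  cderiv (fun s => F s + G s) t (D + E).
Proof.
move=> [F1 F2] [G1 G2]; split.
  rewrite (_ : (fun s => _) = (fun s => complex.Re (F s)) + (fun s => complex.Re (G s))).
    by rewrite raddfD; exact: is_deriveD.
  by apply/funext => s; rewrite raddfD.
rewrite (_ : (fun s => _) = (fun s => complex.Im (F s)) + (fun s => complex.Im (G s))).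
  by rewrite raddfD; exact: is_deriveD.
by apply/funext => s; rewrite raddfD.
Qed.

Lemma cderivM F G t D E : cderiv F t D -> cderiv G t E ->
  cderiv (fun s => F s * G s) t (D * G t + F t * E).
Proof.
move=> [F1 F2] [G1 G2]; split.
  rewrite (_ : (fun s => _) = (fun s => complex.Re (F s)) * (fun s => complex.Re (G s))
     - (fun s => complex.Im (F s)) * (fun s => complex.Im (G s))).
    apply: is_derive_eq (is_deriveB (is_deriveM F1 G1) (is_deriveM F2 G2)) _.
    rewrite /GRing.scale /=.
    by case: D {F1 F2} (F t) E {G1 G2} (G t) => [? ?] [? ?] [? ?] [? ?] /=; ring.
  by apply/funext => s; rewrite !fctE; case: (F s) (G s) => [? ?] [? ?].
rewrite (_ : (fun s => _) = (fun s => complex.Re (F s)) * (fun s => complex.Im (G s))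
     + (fun s => complex.Im (F s)) * (fun s => complex.Re (G s))).
  apply: is_derive_eq (is_deriveD (is_deriveM F1 G2) (is_deriveM F2 G1)) _.
  rewrite /GRing.scale /=.
  by case: D {F1 F2} (F t) E {G1 G2} (G t) => [? ?] [? ?] [? ?] [? ?] /=; ring.
by apply/funext => s; rewrite !fctE; case: (F s) (G s) => [? ?] [? ?].
Qed.

(** The mean value theorem fails for complex values. It is applied to the real and the imaginary
    part, hence the bound [M + M]. *)
Lemma cderiv_mean_value (F D : R -> R[i]) (M : R) :
  (forall t, 0 <= t <= 1 -> cderiv F t (D t)) ->
  (forall t, 0 <= t <= 1 -> cmod (D t) <= M) ->
  cmod (F 1 - F 0) <= M + M.
Proof.
move=> FD DM.
have mv (f df : R -> R) : (forall t, 0 <= t <= 1 -> is_derive t 1 f (df t)) ->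
    (forall t, 0 <= t <= 1 -> `|df t| <= M) -> `|f 1 - f 0| <= M.
  move=> fdf dfM; have [|t||t] := @MVT_segment R f df 0 1.
  - exact: ler01.
  - by rewrite in_itv /= => /andP[/ltW t0 /ltW t1]; apply: fdf; rewrite t0.
  - apply: derivable_within_continuous => t; rewrite in_itv /= => t01.
    by have [] := fdf t t01.
  - by rewrite in_itv /= => t01 ->; rewrite subr0 mulr1; exact: dfM.
set G := F 1 - F 0.
have : `|complex.Re G| <= M.
  rewrite raddfB; apply: (mv (fun t => complex.Re (F t)) (fun t => complex.Re (D t))).
    by move=> t /FD[].
  by move=> t /DM; exact: le_trans (Re_cmod _).
have : `|complex.Im G| <= M.
  rewrite raddfB; apply: (mv (fun t => complex.Im (F t)) (fun t => complex.Im (D t))).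
    by move=> t /FD[].
  by move=> t /DM; exact: le_trans (Im_cmod _).
move=> IM RM; apply: le_trans (_ : `|complex.Re G| + `|complex.Im G| <= _).
  rewrite -(@ler_pXn2r _ 2)// ?nnegrE ?addr_ge0 ?cmod_ge0//.
  rewrite sqr_cmod sqrrD !real_normK ?num_real// addrAC lerDl.
  by rewrite -mulr_natr !mulr_ge0.
exact: lerD.
Qed.

Lemma cmod_powR z al :
  cmod z `^ al = (complex.Re z ^+ 2 + complex.Im z ^+ 2) `^ (al / 2).
Proof. by rewrite cmodE -powR12_sqrt ?addr_ge0 ?sqr_ge0// -powRrM mulrC. Qed.

Lemma cpow_cderiv z t al : cmod z < 1 -> 0 <= t <= 1 ->
  cderiv (fun s => cpow (1 - s%:C * z) al) t
    (- al%:C * z / (1 - t%:C * z) * cpow (1 - t%:C * z) al).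
Proof.
case: z => x y z1 t01.
have p0 : 0 < 1 - t * x.
  have := le_lt_trans (Re_cmod (x +i* y)) z1; rewrite /= ltr_norml => /andP[x1 x2].
  by case/andP: t01 => t0 t1; nra.
(* [p] and [q] are the real and imaginary parts of [1 - s z], and [m] is its squared modulus, so
   that the modulus to the power [al] becomes [m ^ (al / 2)] without a square root. As [p t] is
   positive, the argument [atan (q / p)] is differentiable at [t]. *)
pose p (s : R) := 1 - s * x; pose q (s : R) := - (s * y).
pose m s := p s ^+ 2 + q s ^+ 2; pose th s := atan (q s / p s).
have m0 : 0 < m t by rewrite /m ltr_pwDl ?exprn_gt0// sqr_ge0.
have QE s : 1 - s%:C * (x +i* y) = p s +i* q s by simpc.
have EE s : cpow (1 - s%:C * (x +i* y)) al =
    (m s `^ (al / 2) * cos (al * th s)) +i* (m s `^ (al / 2) * sin (al * th s)).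
  by rewrite QE /cpow cmod_powR.
have dp : is_derive t 1 p (- x).
  by apply: is_derive_eq; rewrite /GRing.scale /=; ring.
have dq : is_derive t 1 q (- y).
  by apply: is_derive_eq; rewrite /GRing.scale /=; ring.
have dm : is_derive t 1 m (- 2 * (p t * x + q t * y)).
  apply: is_derive_eq (is_deriveD (is_deriveX 2 dp) (is_deriveX 2 dq)) _.
  by rewrite /GRing.scale /= !expr1; ring.
have dr : is_derive t 1 (fun s => m s `^ (al / 2))
    (- al * (p t * x + q t * y) / m t * m t `^ (al / 2)).
  apply: is_derive_eq (is_derive1_comp (is_derive1_powR (al / 2) m0) dm) _.
  rewrite powRB ?powRr1 ?(ltW m0)//; last by rewrite (gt_eqF m0) implybT.
  by field; rewrite gt_eqF.
have dth : is_derive t 1 th ((q t * x - p t * y) / m t).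
  have dV := is_deriveV (lt0r_neq0 p0 : p t != 0) dp.
  apply: is_derive_eq (is_derive1_comp (is_derive1_atan _) (is_deriveM dq dV)) _.
  rewrite /GRing.scale /= !fctE /m; field.
  by rewrite !gt_eqF.
have dath : is_derive t 1 (fun s => al * th s) (al * ((q t * x - p t * y) / m t)).
  exact: is_deriveZ.
have dc := is_deriveM dr (is_derive1_comp (is_derive_cos _) dath).
have ds := is_deriveM dr (is_derive1_comp (is_derive_sin _) dath).
have DE : - al%:C * (x +i* y) / (1 - t%:C * (x +i* y)) =
    (- al * (p t * x + q t * y) / m t) +i* (al * ((q t * x - p t * y) / m t)).
  have Q0 : p t +i* q t != 0 :> R[i] by rewrite eq_complex /= negb_and gt_eqF.
  apply: (mulIf Q0); rewrite QE divfK//; apply/eqP; rewrite eq_complex /= /m.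
  by apply/andP; split; apply/eqP; field; rewrite gt_eqF.
split; under [fun s => _]eq_fun do rewrite EE /=.
  by apply: is_derive_eq dc _; rewrite DE EE /GRing.scale /=; ring.
by apply: is_derive_eq ds _; rewrite DE EE /GRing.scale /=; ring.
Qed.

Lemma cpowN z al : 0 < cmod z -> cpow z (- al) * cpow z al = 1.
Proof.
move=> z0; rewrite /cpow powRN mulNr cosN sinN.
set c := cos _; set s := sin _; set r := _ `^ _.
have r0 : r != 0 by rewrite gt_eqF// powR_gt0.
have cs : c ^+ 2 + s ^+ 2 = 1 := cos2Dsin2 _.
apply/eqP; rewrite eq_complex /=; apply/andP; split; apply/eqP; last by field.
by rewrite -cs; field.
Qed.

Lemma cpow1 al : cpow (1 : R[i]) al = 1.
Proof. by rewrite /cpow cmod1 /= mul0r atan0 mulr0 cos0 sin0 powR1 mulr1 mulr0. Qed.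

Lemma cmod_cpow z al : cmod (cpow z al) = cmod z `^ al.
Proof.
rewrite [LHS]cmodE /cpow /= !exprMn -mulrDr cos2Dsin2 mulr1 sqrtr_sqr.
by rewrite ger0_norm// powR_ge0.
Qed.

(** The truncation of [(1 - t z) S' = al z S], the equation of the full series; the cut at [N]
    leaves a single boundary term. *)
Lemma cbin_partial_ode al z t N :
  (1 - t%:C * z) * (\sum_(n < N) (n%:R * cbin al n)%:C * z ^+ n * t%:C ^+ n.-1) =
  al%:C * z * (\sum_(n < N) (cbin al n)%:C * z ^+ n * t%:C ^+ n) -
  (N%:R * cbin al N)%:C * z ^+ N * t%:C ^+ N.-1.
Proof.
elim: N => [|N ih]; first by rewrite !big_ord0 !mulr0 !mul0r subrr.
rewrite !big_ord_recr /= !mulrDr ih cbinS !rmorphM rmorphD /= rmorph_nat exprS.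
case: N {ih} => [|N] /=; first by rewrite !mul0r; ring.
by rewrite [t%:C ^+ N.+1]exprS; ring.
Qed.

Lemma cbin_partial_cderiv al z t N :
  cderiv (fun s => \sum_(n < N) (cbin al n)%:C * z ^+ n * s%:C ^+ n) t
    (\sum_(n < N) (n%:R * cbin al n)%:C * z ^+ n * t%:C ^+ n.-1).
Proof.
have dX n : cderiv (fun s => s%:C ^+ n) t (n%:R * t%:C ^+ n.-1).
  elim: n => [|n ih].
    by under [X in cderiv X]eq_fun do rewrite expr0; rewrite mul0r; exact: cderiv_cst.
  under [X in cderiv X]eq_fun do rewrite exprS.
  have := cderivM (cderiv_scal 1 t) ih.
  under [X in cderiv X]eq_fun do rewrite mulr1.
  congr cderiv; rewrite mulr1 mul1r /= -natr1.
  by case: n {ih} => [|n] /=; rewrite ?exprS; ring.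
elim: N => [|N ih].
  under [X in cderiv X]eq_fun do rewrite big_ord0.
  by rewrite big_ord0; exact: cderiv_cst.
under [X in cderiv X]eq_fun do rewrite big_ord_recr /=.
rewrite big_ord_recr /=; apply: cderivD => //.
have := cderivM (cderiv_cst ((cbin al N)%:C * z ^+ N) t) (dX N).
congr cderiv; rewrite rmorphM /= rmorph_nat; ring.
Qed.

(* With [S N] the partial sum at [t z] and [E t = (1 - t z) ^ al], the derivative of
   [S N t * E t] in [t] telescopes to a single term which tends to 0 with [N], while
   the product is 1 at [t = 0]. *)
Lemma cpow_binomial_series al z : 1 <= al -> cmod z < 1 ->
  csum (fun n => (cbin al n)%:C * z ^+ n) (cpow (1 - z) (- al)).
Proof.
move=> al1 z1; have z0 := cmod_ge0 z.
pose S N t := \sum_(n < N) (cbin al n)%:C * z ^+ n * t%:C ^+ n.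
pose E t := cpow (1 - t%:C * z) al.
have Q0 t : 0 <= t <= 1 -> 0 < cmod (1 - t%:C * z).
  move=> /andP[t0 t1]; have := cmodD (1 - t%:C * z) (t%:C * z).
  rewrite subrK cmod1 cmodM cmodC ger0_norm//; nra.
have Q2 t : 0 <= t <= 1 -> cmod (1 - t%:C * z) <= 2.
  move=> /andP[t0 t1]; have := cmodD 1 (- (t%:C * z)).
  rewrite cmodN cmod1 cmodM cmodC ger0_norm//; nra.
pose D N t := - ((N%:R * cbin al N)%:C * z ^+ N * t%:C ^+ N.-1) *
  (E t / (1 - t%:C * z)).
have SED N t : 0 <= t <= 1 -> cderiv (fun s => S N s * E s) t (D N t).
  move=> t01; have := cderivM (cbin_partial_cderiv al z t N) (cpow_cderiv al z1 t01).
  congr cderiv; rewrite -/(E t) -/(S N t).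
  have := cbin_partial_ode al z t N; rewrite -/(S N t).
  have : 1 - t%:C * z != 0 by rewrite -cmod_eq0 gt_eqF// Q0.
  rewrite /D; set Q := 1 - _; set S' := \sum_(i < N) _ => Qn0 h.
  have -> : S' = (Q * S') / Q by rewrite mulrC mulKf.
  by rewrite h; field.
have DM N t : 0 <= t <= 1 -> cmod (D N t) <= N%:R * cbin al N * cmod z ^+ N * 2 `^ (al - 1).
  move=> t01; rewrite /D !cmodM cmodN !cmodM cmodV !cmodX !cmodC cmod_cpow.
  have c0 : 0 <= N%:R * cbin al N by rewrite mulr_ge0// (le_trans ler01)// cbin_ge1.
  (* The quotient by [1 - t z] lowers the exponent of the modulus to [al - 1], which is nonnegative,
     so the bound 2 on the modulus yields the constant [2 ^ (al - 1)]. *)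
  rewrite -[cmod (1 - _) in X in _ / X](@powRr1 _ (cmod (1 - t%:C * z))) ?cmod_ge0//.
  rewrite -powRB; last by apply/implyP => _; rewrite gt_eqF// Q0.
  have /andP[t0 t1] := t01.
  rewrite (ger0_norm c0) (ger0_norm t0); apply: ler_pM.
  - by rewrite mulr_ge0 ?exprn_ge0// mulr_ge0 ?exprn_ge0.
  - exact: powR_ge0.
  - by rewrite ler_piMr ?exprn_ile1// mulr_ge0 ?exprn_ge0.
  - by apply: ge0_ler_powR; rewrite ?subr_ge0 ?nnegrE ?cmod_ge0// Q2.
have E1 : E 1 = cpow (1 - z) al by rewrite /E mul1r.
have S0 N : S N.+1 0 * E 0 = 1.
  rewrite /S big_ord_recl big1 => [|i _]; last by rewrite expr0n mulr0.
  by rewrite cbin0 !expr0 !mulr1 /E mul0r subr0 cpow1 addr0 mulr1.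
have h1 := Q0 1 (introT andP (conj ler01 (lexx 1))).
rewrite mul1r in h1.
have EV := cpowN al h1.
pose K := cmod (cpow (1 - z) (- al)).
(* [K] turns the distance of [S N 1 * E 1] from 1 into that of [S N 1] from the inverse of [E 1];
   the last factor 2 comes from [cderiv_mean_value]. *)
suff : (fun N => K * (N%:R * cbin al N * cmod z ^+ N * (2 `^ (al - 1)) * 2)) @ \oo --> (0 : R).
  (* The shift discards the empty partial sum, which is 0 rather than 1 at [t = 0]. *)
  rewrite -cvg_shiftS => /cvg0_le h; rewrite /csum -cvg_shiftS; apply: h => N.
  rewrite cmod_ge0 /=.
  have := cderiv_mean_value (SED N.+1) (DM N.+1).
  rewrite S0 E1 => mv; set T := \sum_(m < N.+1) _.
  have -> : cpow (1 - z) (- al) - T =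
      cpow (1 - z) (- al) * - (S N.+1 1 * cpow (1 - z) al - 1).
    rewrite opprB mulrBr mulr1 mulrCA EV mulr1; congr (_ - _).
    by rewrite /S /T; apply: eq_bigr => i _; rewrite expr1n mulr1.
  rewrite cmodM cmodN ler_wpM2l ?cmod_ge0//; apply: le_trans mv _.
  by rewrite mulr_natr mulr2n.
rewrite (_ : 0 = K * (0 * 2 `^ (al - 1) * 2)); last by rewrite !mul0r mulr0.
apply: cvgM; first exact: cvg_cst.
apply: cvgM; last exact: cvg_cst.
apply: cvgM; last exact: cvg_cst.
by apply: cbin_power_cvg0 => //; rewrite z0.
Qed.

Lemma geo_csum al lam w z : 1 <= al -> cmod w < 1 -> cmod z < 1 ->
  csum (fun n => geo al lam w n * z ^+ n) (lam * cpow (1 - w * z) (- al)).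
Proof.
move=> al1 w1 z1; have wz1 : cmod (w * z) < 1.
  by rewrite cmodM; have := cmod_ge0 w; have := cmod_ge0 z; nra.
have := cpow_binomial_series al1 wz1; rewrite /csum => h.
rewrite (_ : (fun n => _) = (fun n => cmod lam * cmod (cpow (1 - w * z) (- al) -
    \sum_(m < n) (cbin al m)%:C * (w * z) ^+ m))).
  by rewrite -(mulr0 (cmod lam)); apply: cvgM => //; exact: cvg_cst.
apply/funext => n; rewrite -cmodM mulrBr mulr_sumr; congr (cmod (_ - _)).
by apply: eq_bigr => i _; rewrite /geo exprMn; ring.
Qed.

End BinomialSeries.

(** * Parseval's identity and the Hardy norm *)

Section Parseval.
Variable R : realType.
Local Notation mu := (@lebesgue_measure R).

Definition ccont (T : topologicalType) (F : T -> R[i]) :=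
  continuous (fun x => complex.Re (F x)) /\ continuous (fun x => complex.Im (F x)).

Lemma ccont_cst (T : topologicalType) (z : R[i]) : ccont (fun _ : T => z).
Proof. by split => x; exact: cvg_cst. Qed.

Lemma ccontD (T : topologicalType) (F G : T -> R[i]) :
  ccont F -> ccont G -> ccont (fun x => F x + G x).
Proof.
move=> [F1 F2] [G1 G2]; split; under [X in continuous X]eq_fun do rewrite raddfD.
  by move=> x; apply: cvgD; [exact: F1|exact: G1].
by move=> x; apply: cvgD; [exact: F2|exact: G2].
Qed.

Lemma complex_ReM (z w : R[i]) : complex.Re (z * w) =
  complex.Re z * complex.Re w - complex.Im z * complex.Im w.
Proof. by case: z w => [? ?] [? ?]. Qed.

Lemma complex_ImM (z w : R[i]) : complex.Im (z * w) =
  complex.Re z * complex.Im w + complex.Im z * complex.Re w.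
Proof. by case: z w => [? ?] [? ?]. Qed.

Lemma ccontM (T : topologicalType) (F G : T -> R[i]) :
  ccont F -> ccont G -> ccont (fun x => F x * G x).
Proof.
move=> [F1 F2] [G1 G2]; split.
  under [X in continuous X]eq_fun do rewrite complex_ReM; move=> x.
  by apply: cvgB; apply: cvgM; [exact: F1|exact: G1|exact: F2|exact: G2].
under [X in continuous X]eq_fun do rewrite complex_ImM; move=> x.
by apply: cvgD; apply: cvgM; [exact: F1|exact: G2|exact: F2|exact: G1].
Qed.

Lemma ccontX (T : topologicalType) (F : T -> R[i]) n :
  ccont F -> ccont (fun x => F x ^+ n).
Proof.
move=> cF; elim: n => [|n ih].
  by under [X in ccont X]eq_fun do rewrite expr0; exact: ccont_cst.
by under [X in ccont X]eq_fun do rewrite exprS; exact: ccontM.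
Qed.

Lemma ccont_poly (T : topologicalType) (F : T -> R[i]) (b : nat -> R[i]) N :
  ccont F -> ccont (fun x => \sum_(n < N) b n * F x ^+ n).
Proof.
move=> cF; elim: N => [|N ih].
  by under [X in ccont X]eq_fun do rewrite big_ord0; exact: ccont_cst.
under [X in ccont X]eq_fun do rewrite big_ord_recr /=.
by apply: ccontD => //; apply: ccontM; [exact: ccont_cst|exact: ccontX].
Qed.

Lemma ccont_sqr_cmod (T : topologicalType) (F : T -> R[i]) :
  ccont F -> continuous (fun x => cmod (F x) ^+ 2).
Proof.
move=> [F1 F2]; under [X in continuous X]eq_fun do rewrite sqr_cmod.
by move=> x; apply: cvgD; apply: cvgM; do ?[exact: F1|exact: F2].
Qed.

Definition cis (t : R) : R[i] := cos t +i* sin t.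

Lemma cisX t n : cis t ^+ n = cis (n%:R * t).
Proof.
elim: n => [|n ih]; first by rewrite mul0r /cis cos0 sin0.
rewrite exprS ih -nat1r mulrDl mul1r /cis cosD sinD.
by apply/eqP; rewrite eq_complex /= eqxx addrC eqxx.
Qed.

Lemma cmod_cis t : cmod (cis t) = 1.
Proof. by rewrite cmodE /= cos2Dsin2 sqrtr1. Qed.

Lemma ccont_cis : ccont cis.
Proof. by split => x; [exact: continuous_cos|exact: continuous_sin]. Qed.

Lemma cisD2pi t : cis (t + 2 * pi) = cis t.
Proof. by rewrite /cis (_ : 2 * pi = pi *+ 2) ?mulr_natl// cosD2pi sinD2pi. Qed.

(** Orthogonality of distinct frequencies, encoded as a periodic antiderivative: its increment over
    a period is 0. *)
Lemma trig_antiderivative (c : R[i]) (k : nat) : exists F : R -> R,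
  (forall t : R, is_derive t 1 F (complex.Re (c * (cis t ^+ k.+1)^*%C))) /\
  (forall t : R, F (t + 2 * pi) = F t).
Proof.
exists (fun t => complex.Im (c^*%C * cis t ^+ k.+1) / k.+1%:R); split; last first.
  by move=> t; rewrite cisD2pi.
move=> t; under [X in is_derive _ _ X]eq_fun do rewrite cisX.
rewrite cisX; case: c => x y /=.
have : k.+1%:R != 0 :> R by rewrite pnatr_eq0.
move: k.+1%:R => K k0.
rewrite (_ : (fun s => _) = (fun s => (x * sin (K * s) - y * cos (K * s)) * K^-1)).
  apply: is_derive_eq; rewrite /GRing.scale /=; field.
  by rewrite k0.
by apply/funext => s; rewrite mulNr.
Qed.

Lemma trig_sum_antiderivative (c : nat -> R[i]) (k : nat -> nat) M :
  exists F : R -> R,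
  (forall t : R, is_derive t 1 F
    (complex.Re (\sum_(n < M) c n * (cis t ^+ (k n).+1)^*%C))) /\
  (forall t : R, F (t + 2 * pi) = F t).
Proof.
elim: M => [|M [F [dF pF]]].
  by exists (fun=> 0); split => // t; rewrite big_ord0; exact: is_derive_cst.
have [G [dG pG]] := trig_antiderivative (c M) (k M).
exists (F + G); split => t; last by rewrite !fctE pF pG.
by rewrite big_ord_recr raddfD /=; apply: is_deriveD.
Qed.

Lemma sqr_cmodD (z w : R[i]) :
  cmod (z + w) ^+ 2 = cmod z ^+ 2 + cmod w ^+ 2 + 2 * complex.Re (z * w^*%C).
Proof. by rewrite !sqr_cmod; case: z w => [? ?] [? ?] /=; ring. Qed.

Lemma cis_conjM t m n : (m <= n)%N ->
  cis t ^+ m * (cis t ^+ n)^*%C = (cis t ^+ (n - m))^*%C.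
Proof.
move=> mn; rewrite -[in LHS](subnKC mn) exprD rmorphM mulrA -/(_^*%C).
rewrite -sqr_normc -cmod_norm cmodX cmod_cis expr1n expr1n.
by rewrite mul1r.
Qed.

(** Diagonal terms contribute linearly in [t] and cross terms periodically, so only the former
    survive over a period. An antiderivative is kept instead of an integral because it serves both
    an interval and the substitution by [atan]. *)
Lemma sqr_cmod_antiderivative (b : nat -> R[i]) N : exists F : R -> R,
  (forall t : R, is_derive t 1 F (cmod (\sum_(n < N) b n * cis t ^+ n) ^+ 2)) /\
  (forall t : R, F (t + 2 * pi) = F t + 2 * pi * \sum_(n < N) cmod (b n) ^+ 2).
Proof.
elim: N => [|N [F [dF pF]]].
  exists (fun=> 0); split => t; rewrite big_ord0.
    by rewrite cmod0 expr0n; exact: is_derive_cst.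
  by rewrite mulr0 addr0.
(* The predecessor offsets the [.+1] in the exponent there: the cross term of [n] and [N] has
   frequency [N - n], at least 1. *)
have [G [dG pG]] := trig_sum_antiderivative (fun n => b n * (b N)^*%C)
  (fun n => (N - n).-1) N.
exists (fun t => F t + cmod (b N) ^+ 2 * t + 2 * G t); split => t; last first.
  by rewrite pF pG big_ord_recr /=; ring.
rewrite big_ord_recr /= sqr_cmodD.
have -> : complex.Re ((\sum_(n < N) b n * cis t ^+ n) * (b N * cis t ^+ N)^*%C) =
    complex.Re (\sum_(n < N) b n * (b N)^*%C * (cis t ^+ (N - n).-1.+1)^*%C).
  rewrite mulr_suml; congr complex.Re; apply: eq_bigr => i _.
  rewrite prednK ?subn_gt0// -cis_conjM ?(ltnW (ltn_ord i))// rmorphM /=.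
  by ring.
have := dG t; have := dF t => ? ?; apply: is_derive_eq.
by rewrite /GRing.scale /= cmodM cmodX cmod_cis expr1n; ring.
Qed.

Lemma integral_sqr_cmod_partial (b : nat -> R[i]) N (a : R) :
  (\int[mu]_(t in `[a, (a + 2 * pi)%R])
    (cmod (\sum_(n < N) b n * cis t ^+ n) ^+ 2)%R%:E =
   (2 * pi * \sum_(n < N) cmod (b n) ^+ 2)%R%:E)%E.
Proof.
have [F [dF pF]] := sqr_cmod_antiderivative b N.
have dvF t : derivable F t 1 by have [] := dF t.
have cF : continuous F by move=> t; apply: differentiable_continuous; exact/derivable1_diffP.
rewrite (@continuous_FTC2 _ _ F).
- by rewrite -EFinB pF addrAC subrr add0r.
- by rewrite ltrDl mulr_gt0// pi_gt0.
- apply: continuous_subspaceT; apply: ccont_sqr_cmod.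
  exact/ccont_poly/ccont_cis.
- split => [x _ //||].
    by apply: cvg_at_right_filter; exact: cF.
  by apply: cvg_at_left_filter; exact: cF.
- by move=> t _; rewrite derive1E; have [_ ->] := dF t.
Qed.

Lemma csum_cvg_sqr_cmod (a : nat -> R[i]) s : csum a s ->
  (fun n => cmod (\sum_(m < n) a m) ^+ 2) @ \oo --> cmod s ^+ 2.
Proof.
move=> h.
suff c1 : (fun n => cmod (\sum_(m < n) a m)) @ \oo --> cmod s by exact: cvgM.
apply/subr_cvg0; apply: norm_cvg0; apply: cvg0_le h => n.
by rewrite normr_ge0 /= cmod_sub cmod_dist.
Qed.

Lemma sqr_summable (b : nat -> R[i]) : cvgn (psum (fun n => cmod (b n))) ->
  exists B : R, psum (fun n => cmod (b n) ^+ 2) @ \oo --> B.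
Proof.
move=> /cvg_ex[/= A cA]; have b0 n : 0 <= cmod (b n) by exact: cmod_ge0.
have [||B cB _] := @psum_bounded _ (fun n => cmod (b n) ^+ 2) (A * A).
- by move=> n; exact: sqr_ge0.
- move=> N; have bA n : cmod (b n) <= A.
    by apply: le_trans (psum_le b0 cA n.+1); rewrite big_ord_recr /= lerDr sumr_ge0.
  apply: le_trans (_ : A * \sum_(i < N) cmod (b i) <= _).
    by rewrite mulr_sumr; apply: ler_sum => i _; rewrite expr2 ler_wpM2r.
  by rewrite ler_wpM2l ?(psum_le b0 cA)//; exact: le_trans (bA 0%N).
by exists B.
Qed.

(** Dominated convergence from the partial sums, the bound being [M ^+ 2] with [M] the sum of the
    moduli. *)
Lemma parseval (b : nat -> R[i]) (B : R) (g : R -> R[i]) (a : R) :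
  cvgn (psum (fun n => cmod (b n))) ->
  psum (fun n => cmod (b n) ^+ 2) @ \oo --> B ->
  (forall t, csum (fun n => b n * cis t ^+ n) (g t)) ->
  (\int[mu]_(t in `[a, (a + 2 * pi)%R]) (cmod (g t) ^+ 2)%R%:E =
   (2 * pi * B)%R%:E)%E.
Proof.
move=> /cvg_ex[/= M cM] cB bg.
have b0 n : 0 <= cmod (b n) by exact: cmod_ge0.
pose f N t := (cmod (\sum_(n < N) b n * cis t ^+ n) ^+ 2)%:E.
have fM N t : (`|f N t| <= (M ^+ 2)%:E)%E.
  rewrite /f /= normrX ger0_norm ?cmod_ge0// lee_fin.
  rewrite lerXn2r ?nnegrE ?cmod_ge0//.
    by have := psum_le b0 cM 0; rewrite big_ord0.
  apply: le_trans (cmod_sum _ _ _) (le_trans _ (psum_le b0 cM N)).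
  by apply: ler_sum => i _; rewrite cmodM cmodX cmod_cis expr1n mulr1.
have cf N : continuous (fun t : R => cmod (\sum_(n < N) b n * cis t ^+ n) ^+ 2).
  by apply: ccont_sqr_cmod; exact/ccont_poly/ccont_cis.
have := @dominated_cvg _ _ _ mu `[a, a + 2 * pi] (measurable_itv _) f
  (fun t => (cmod (g t) ^+ 2)%:E) (cst (M ^+ 2)%:E).
have -> : (fun n => \int[mu]_(x in `[a, (a + 2 * pi)%R]) f n x)%E =
    EFin \o (fun n => 2 * pi * \sum_(i < n) cmod (b i) ^+ 2).
  by apply/funext => n; rewrite integral_sqr_cmod_partial.
move=> h; apply: (cvg_unique _ (h _ _ _ _ _)) => {h} //.
- move=> N; apply/measurable_EFinP; apply: measurable_funTS.
  by apply: continuous_measurable_fun; exact: (cf N).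
- move=> t _; apply/cvg_EFin; first exact: nearW.
  exact: (csum_cvg_sqr_cmod (bg t)).
- apply: (measurable_bounded_integrable (f := cst (M ^+ 2))) => //.
    by rewrite /= lebesgue_measure_itv /=; case: ifP => // _; rewrite ltry.
  exists (M ^+ 2); split => [|K MK x _ /=]; first exact: num_real.
  by rewrite ger0_norm ?sqr_ge0// ltW.
- apply/cvg_EFin; first exact: nearW.
  by apply: cvgM => //; exact: cvg_cst.
Qed.

End Parseval.

Section Hardy.
Variable R : realType.
Implicit Types (f : R[i] -> R[i]) (a : nat -> R[i]).
Local Notation mu := (@lebesgue_measure R).

Definition represents f a :=
  forall z, cmod z < 1 -> csum (fun n => a n * z ^+ n) (f z).

Lemma represents_abs_cvg f a r : represents f a -> 0 <= r < 1 ->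
  cvgn (psum (fun n => cmod (a n * r%:C ^+ n))).
Proof.
move=> fa /andP[r0 r1].
have := @power_series_abs_cvg R a 1 _ r; rewrite r0 r1.
have E n : cmod (a n * r%:C ^+ n) = cmod (a n) * r ^+ n.
  by rewrite cmodM cmodX cmodC ger0_norm.
by rewrite (eq_psum E) => /(_ _ isT); apply => z /fa; exists (f z).
Qed.

Lemma sqr_cmod_powers a r n :
  cmod (a n * r%:C ^+ n) ^+ 2 = cmod (a n) ^+ 2 * r ^+ (2 * n).
Proof.
by rewrite cmodM exprMn cmodX cmodC -exprM mulnC [LHS]mulrC exprM real_normK ?num_real// -exprM mulrC.
Qed.

Lemma represents_sqr_summable f a r : represents f a -> 0 <= r < 1 ->
  exists B : R, psum (fun n => cmod (a n) ^+ 2 * r ^+ (2 * n)) @ \oo --> B.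
Proof.
move=> fa r01; have [B cB] := @sqr_summable R (fun n => a n * r%:C ^+ n) (represents_abs_cvg fa r01).
by exists B; rewrite -(eq_psum (fun n => sqr_cmod_powers a r n)).
Qed.

Lemma circle_mean f a r B (t0 : R) : represents f a -> 0 <= r < 1 ->
  psum (fun n => cmod (a n) ^+ 2 * r ^+ (2 * n)) @ \oo --> B ->
  (\int[mu]_(t in `[t0, (t0 + 2 * pi)%R])
     (cmod (f (r * cos t +i* (r * sin t))) ^+ 2)%R%:E = (2 * pi * B)%R%:E)%E.
Proof.
move=> fa r01 cB.
apply: (@parseval _ (fun n => a n * r%:C ^+ n)).
- exact: represents_abs_cvg fa r01.
- by rewrite (eq_psum (fun n => sqr_cmod_powers a r n)).
move=> t; have -> : r * cos t +i* (r * sin t) = r%:C * cis t by rewrite /cis; simpc.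
have : cmod (r%:C * cis t) < 1.
  by case/andP: r01 => r0 r1; rewrite cmodM cmodC cmod_cis mulr1 ger0_norm.
move=> /fa; rewrite (_ : (fun n => _) = (fun n => a n * r%:C ^+ n * cis t ^+ n))//.
by apply/funext => n; rewrite exprMn mulrA.
Qed.

Definition cmeas d (T : measurableType d) (D : set T) (F : T -> R[i]) :=
  measurable_fun D (fun x => complex.Re (F x)) /\
  measurable_fun D (fun x => complex.Im (F x)).

Lemma cmeas_cst d (T : measurableType d) (D : set T) (z : R[i]) :
  cmeas D (fun=> z).
Proof. by split; exact: measurable_cst. Qed.

Lemma cmeasD d (T : measurableType d) (D : set T) (F G : T -> R[i]) :
  cmeas D F -> cmeas D G -> cmeas D (fun x => F x + G x).
Proof.
move=> [F1 F2] [G1 G2]; split; under [X in measurable_fun _ X]eq_fun do rewrite raddfD.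
  exact: measurable_funD.
exact: measurable_funD.
Qed.

Lemma cmeasM d (T : measurableType d) (D : set T) (F G : T -> R[i]) :
  cmeas D F -> cmeas D G -> cmeas D (fun x => F x * G x).
Proof.
move=> [F1 F2] [G1 G2]; split.
  under [X in measurable_fun _ X]eq_fun do rewrite complex_ReM.
  by apply: measurable_funB; exact: measurable_funM.
under [X in measurable_fun _ X]eq_fun do rewrite complex_ImM.
by apply: measurable_funD; exact: measurable_funM.
Qed.

Lemma cmeas_poly d (T : measurableType d) (D : set T) (F : T -> R[i])
    (b : nat -> R[i]) N :
  cmeas D F -> cmeas D (fun x => \sum_(n < N) b n * F x ^+ n).
Proof.
move=> cF; have cX n : cmeas D (fun x => F x ^+ n).
  elim: n => [|n ih].
    by under [X in cmeas _ X]eq_fun do rewrite expr0; exact: cmeas_cst.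
  by under [X in cmeas _ X]eq_fun do rewrite exprS; exact: cmeasM.
elim: N => [|N ih].
  by under [X in cmeas _ X]eq_fun do rewrite big_ord0; exact: cmeas_cst.
under [X in cmeas _ X]eq_fun do rewrite big_ord_recr /=.
by apply: cmeasD => //; apply: cmeasM => //; exact: cmeas_cst.
Qed.

(** Measurability is inherited from the polynomial partial sums, which converge pointwise. *)
Lemma measurable_sqr_cmod_represents d (T : measurableType d) (D : set T)
    (F : T -> R[i]) f a : represents f a -> cmeas D F ->
  (forall x, D x -> cmod (F x) < 1) ->
  measurable_fun D (fun x => cmod (f (F x)) ^+ 2).
Proof.
move=> fa cF F1; apply: (@measurable_realfun.measurable_fun_cvg _ _ _ _
  (fun N x => cmod (\sum_(n < N) a n * F x ^+ n) ^+ 2)).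
  move=> N; have [m1 m2] := cmeas_poly a N cF.
  under [X in measurable_fun _ X]eq_fun do rewrite sqr_cmod.
  by apply: measurable_funD; apply: measurable_funX.
by move=> x /F1/fa; exact: csum_cvg_sqr_cmod.
Qed.

Definition circle_norm f r : \bar R :=
  ((\int[mu]_(t in `[0%R, (2 * pi)%R])
    ((cmod (f (r * cos t +i* (r * sin t))) `^ 2 / (2 * pi))%R)%:E) `^ 2^-1)%E.

Lemma circle_normE f a r B : represents f a -> 0 < r < 1 ->
  psum (fun n => cmod (a n) ^+ 2 * r ^+ (2 * n)) @ \oo --> B ->
  circle_norm f r = (B `^ 2^-1)%:E.
Proof.
move=> fa /andP[r0 r1] cB; rewrite /circle_norm -poweR_EFin; congr poweR.
have pi0 : 0 < 2 * pi :> R by rewrite mulr_gt0// pi_gt0.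
have r01 : 0 <= r < 1 by rewrite ltW.
have mE := circle_mean 0 fa r01 cB; rewrite add0r in mE.
transitivity ((2 * pi)^-1%:E * \int[mu]_(t in `[0%R, (2 * pi)%R])
     (cmod (f (r * cos t +i* (r * sin t))) ^+ 2)%:E)%E; last first.
  by rewrite mE -EFinM mulrA mulVf ?mul1r// gt_eqF.
rewrite -ge0_integralZl//.
- by apply: eq_integral => t _; rewrite -EFinM mulrC powR_mulrn// cmod_ge0.
- apply/measurable_EFinP; apply: (measurable_sqr_cmod_represents fa).
    split => /=; apply: measurable_funM => //; apply: measurable_funTS;
      apply: continuous_measurable_fun; [exact: continuous_cos|exact: continuous_sin].
  move=> t _; rewrite cmodE /= !exprMn -mulrDr cos2Dsin2 mulr1.
  by rewrite sqrtr_sqr ger0_norm ?(ltW r0).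
- by move=> t _; rewrite lee_fin sqr_ge0.
- by rewrite lee_fin invr_ge0 ltW.
Qed.

Lemma hardy_normE f : hardy_norm 2 f = ereal_sup [set circle_norm f r | r in [set r | 0 < r < 1]].
Proof. by []. Qed.

Lemma cvg_le (T : Type) (F : set_system T) {FF : ProperFilter F} (u : T -> R)
    (l M : R) : u x @[x --> F] --> l -> (\forall x \near F, u x <= M) -> l <= M.
Proof.
move=> cu uM; rewrite -(cvg_lim (@Rhausdorff R) cu).
by apply: limr_le => //; apply/cvg_ex; exists l.
Qed.

(** The finite sum is a polynomial in [r], so the bound passes to the limit at 1 from the left. *)
Lemma psum_at1 (x : nat -> R) N (M : R) :
  (forall r : R, 0 < r < 1 -> \sum_(n < N) x n * r ^+ (2 * n) <= M) ->
  \sum_(n < N) x n <= M.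
Proof.
move=> xM; pose h r : R := \sum_(n < N) x n * r ^+ (2 * n).
have ch : continuous h.
  rewrite /h; elim: N {xM h} => [|N ih].
    by under [X in continuous X]eq_fun do rewrite big_ord0; move=> r; exact: cvg_cst.
  under [X in continuous X]eq_fun do rewrite big_ord_recr /=.
  move=> r; apply: cvgD; first exact: ih.
  by apply: cvgM; [exact: cvg_cst|exact: exprn_continuous].
have h1 : h r @[r --> 1^'-] --> h 1 by apply: cvg_at_left_filter; exact: ch.
rewrite (_ : \sum_(n < N) x n = h 1); last first.
  by apply: eq_bigr => i _; rewrite expr1n mulr1.
apply: (cvg_le h1).
near=> r; apply: xM; apply/andP; split; near: r.
  exact: nbhs_left_gt.
exact: nbhs_left_lt.
Unshelve. all: by end_near. Qed.

Lemma wsq1 a n : wsq 1 a n = cmod (a n) ^+ 2.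
Proof. by rewrite /wsq cbin1 divr1. Qed.

Lemma powR12_le (x y : R) : 0 <= x -> x `^ 2^-1 <= y -> x <= y ^+ 2.
Proof.
move=> x0 xy; have y0 : 0 <= y by exact: le_trans (powR_ge0 _ _) xy.
rewrite -[x]sqr_sqrtr// -powR12_sqrt// lerXn2r ?nnegrE ?powR_ge0//.
Qed.

(** Each partial sum is bounded on a circle, and then [r] tends to 1 with [N] fixed, so no two
    limits are exchanged. *)
Lemma hardy_norm_bound f a (S : R) : represents f a ->
  (hardy_norm 2 f <= S%:E)%E -> forall N, \sum_(n < N) wsq 1 a n <= S ^+ 2.
Proof.
move=> fa fS N; under eq_bigr do rewrite wsq1; apply: (@psum_at1 (fun n => cmod (a n) ^+ 2)) => r r01.
have r01' : 0 <= r < 1 by case/andP: r01 => /ltW -> ->.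
have [B cB] := represents_sqr_summable fa r01'.
have x0 n : 0 <= cmod (a n) ^+ 2 * r ^+ (2 * n).
  by case/andP: r01' => r0 _; rewrite mulr_ge0 ?sqr_ge0 ?exprn_ge0.
apply: le_trans (psum_le x0 cB N) _; apply: powR12_le.
  by have := psum_le x0 cB 0; rewrite big_ord0.
rewrite -lee_fin -(circle_normE fa r01 cB); apply: le_trans fS.
by rewrite hardy_normE; apply: ereal_sup_ubound; exists r.
Qed.

Lemma circle_norm_ge0 f r : (0 <= circle_norm f r)%E.
Proof. exact: poweR_ge0. Qed.

Lemma hardy_norm_ge0 f : (0 <= hardy_norm 2 f)%E.
Proof.
apply: le_trans (circle_norm_ge0 f 2^-1) _.
rewrite hardy_normE; apply: ereal_sup_ubound; exists 2^-1 => //=.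
by apply/andP; split; lra.
Qed.

Lemma hardy_norm_sqnorm f a X : represents f a -> sqnorm 1 a X ->
  hardy_norm 2 f = (X `^ 2^-1)%:E.
Proof.
move=> fa aX; have w0 n : 0 <= wsq 1 a n by exact: wsq_ge0.
have X0 : 0 <= X by exact: sqnorm_ge0 aX.
have le : (hardy_norm 2 f <= (X `^ 2^-1)%:E)%E.
  rewrite hardy_normE; apply: ub_ereal_sup => _ [r r01 <-].
  have /andP[r0 r1] := r01; have r01' : 0 <= r < 1 by rewrite ltW.
  have [B cB] := represents_sqr_summable fa r01'.
  rewrite (circle_normE fa r01 cB) lee_fin.
  have x0 n : 0 <= cmod (a n) ^+ 2 * r ^+ (2 * n).
    by rewrite mulr_ge0 ?sqr_ge0 ?exprn_ge0 ?ltW.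
  have B0 : 0 <= B by have := psum_le x0 cB 0; rewrite big_ord0.
  apply: ge0_ler_powR; rewrite ?nnegrE//.
  apply: (cvg_le cB).
  apply: nearW => N; apply: le_trans (psum_le w0 aX N); apply: ler_sum => i _.
  by rewrite wsq1 ler_piMr ?sqr_ge0// exprn_ile1// ltW.
apply/eqP; rewrite eq_le le /=.
have fin : hardy_norm 2 f \is a fin_num.
  by rewrite ge0_fin_numE ?hardy_norm_ge0// (le_lt_trans le)// ltry.
rewrite -(fineK fin) lee_fin.
have h0 : 0 <= fine (hardy_norm 2 f) by rewrite fine_ge0 ?hardy_norm_ge0.
rewrite powR12_sqrt// -[leRHS]ger0_norm// -sqrtr_sqr ler_wsqrtr//.
apply: (cvg_le aX).
by apply: nearW; apply: (hardy_norm_bound fa); rewrite fineK.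
Qed.

Lemma hardy_norm_fin f a : represents f a -> (hardy_norm 2 f < +oo)%E ->
  exists X, sqnorm 1 a X.
Proof.
move=> fa ffin.
have fin : hardy_norm 2 f \is a fin_num by rewrite ge0_fin_numE ?hardy_norm_ge0.
have [||X cX _] := @psum_bounded _ (wsq 1 a) (fine (hardy_norm 2 f) ^+ 2).
- by move=> n; exact: wsq_ge0.
- by apply: (hardy_norm_bound fa); rewrite fineK.
by exists X.
Qed.

End Hardy.

(** * Polar coordinates and the Bergman norm *)

Section Polar.
Variable R : realType.
Local Notation mu := (@lebesgue_measure R).
Local Open Scope ereal_scope.

(** By uniqueness of Lebesgue measure it is enough to compare half-open intervals; a negative [c]
    exchanges the ends and the side that is closed. *)
Lemma lebesgue_measure_scale (c : R) (A : set R) : c != 0%R -> measurable A ->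
  `|c|%:E * pushforward mu (fun x => (c * x)%R : measurableTypeR R) A = mu A.
Proof.
move=> c0 mA.
have mc : measurable_fun [set: measurableTypeR R]
    (fun x => (c * x)%R : measurableTypeR R).
  by apply: measurable_funM.
pose nu := mscale (NngNum (normr_ge0 c)) (pushforward mu (fun x => (c * x)%R : measurableTypeR R)).
suff -> : mu A = nu mc A by [].
apply: lebesgue_measure_unique => // _ [[a b]] _ <-.
rewrite [RHS](_ : _ = `|c|%:E * mu ((fun x : R => (c * x)%R) @^-1` `]a, b]))//.
have [cp|cn|/eqP] := ltgtP c 0%R; last by rewrite (negPf c0).
- rewrite [X in _ * mu X](_ : _ = `[(b / c)%R, (a / c)%R[%classic); last first.
    apply/seteqP; split => x /=; rewrite !in_itv /= => /andP[h1 h2].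
      by rewrite ler_ndivrMr// ltr_ndivlMr// mulrC h2 h1.
    by rewrite mulrC -ltr_ndivlMr// -ler_ndivrMr// h2 h1.
  rewrite !lebesgue_measure_itv /= !lte_fin ltr_ndivlMr// divfK//.
  case: ifPn => ab; rewrite ?mule0// -EFinM ltr0_norm//; congr EFin.
  by field.
- rewrite [X in _ * mu X](_ : _ = `](a / c)%R, (b / c)%R]%classic); last first.
    apply/seteqP; split => x /=; rewrite !in_itv /= => /andP[h1 h2].
      by rewrite ler_pdivlMr// ltr_pdivrMr// mulrC h1 h2.
    by rewrite mulrC -ltr_pdivrMr// -ler_pdivlMr// h1 h2.
  rewrite !lebesgue_measure_itv /= !lte_fin ltr_pdivlMr// divfK//.
  case: ifPn => ab; rewrite ?mule0// -EFinM gtr0_norm//; congr EFin.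
  by field.
Qed.

Lemma ge0_integral_scale (c : R) (h : R -> \bar R) : c != 0%R ->
  measurable_fun [set: R] h -> (forall x, 0 <= h x) ->
  \int[mu]_x h x = \int[mu]_x (`|c|%:E * h (c * x)%R).
Proof.
move=> c0 mh h0.
have mc : measurable_fun [set: measurableTypeR R]
    (fun x => (c * x)%R : measurableTypeR R).
  by apply: measurable_funM.
rewrite ge0_integralZl//; last first.
  by apply: measurableT_comp.
pose nu := mscale (NngNum (normr_ge0 c)) (pushforward mu (fun x => (c * x)%R : measurableTypeR R)).
rewrite [LHS](eq_measure_integral (nu mc)) => [|A mA _]; last first.
  exact/esym/lebesgue_measure_scale.
rewrite [LHS]ge0_integral_mscale//; congr (_ * _).
by rewrite ge0_integral_pushforward.
Qed.

Lemma ge0_integral_fold (h : R -> \bar R) :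
  measurable_fun [set: R] h -> (forall x, 0 <= h x) ->
  \int[mu]_x h x = \int[mu]_(x in `[0%R, +oo[) (h x + h (- x)%R).
Proof.
move=> mh h0.
have mN : measurable_fun [set: R] (fun x => h (- x)%R) by apply: measurableT_comp.
rewrite ge0_integralD//; last 2 first.
- exact: measurable_funTS.
- exact: measurable_funTS.
rewrite [X in _ = _ + X](ge0_integration_by_substitution0 mN)//.
under [X in _ = _ + X]eq_integral do rewrite opprK.
rewrite -(@integral_itv_bndo_bndc _ _ _ h); last exact: measurable_funTS.
have -> : [set: R] = `[0%R, +oo[ `|` `]-oo, 0%R[.
  by rewrite -(setUv `[0%R, +oo[%classic) setCitvr.
rewrite ge0_integral_setU//.
- exact: measurable_funTS.
- by rewrite -setCitvr; exact/disj_setPCl.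
Qed.

Lemma sin_atan (u : R) : sin (atan u) = (u * cos (atan u))%R.
Proof.
have c0 : cos (atan u) != 0%R :> R.
  by rewrite cos_atan invr_eq0 gt_eqF// sqrtr_gt0 ltr_pwDl// sqr_ge0.
by rewrite -{2}(atanK u) /tan divfK.
Qed.

Lemma cos_atan_gt0 (u : R) : (0 < cos (atan u))%R.
Proof. by rewrite cos_atan invr_gt0 sqrtr_gt0 ltr_pwDl// sqr_ge0. Qed.

Lemma sqr_cos_atan (u : R) : (cos (atan u) ^+ 2 = (1 + u ^+ 2)^-1)%R.
Proof. by rewrite cos_atan exprVn sqr_sqrtr// addr_ge0// sqr_ge0. Qed.

Lemma measurable_cos_atan : measurable_fun [set: R] (fun u => cos (atan u) : R).
Proof.
apply: continuous_measurable_fun => u.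
apply: continuous_comp; first exact: continuous_atan.
exact: continuous_cos.
Qed.

(** Meant for the substitution [y = x * u], which degenerates on the null line [x = 0]. *)
Lemma eq_integral_neq0 (h1 h2 : R -> \bar R) :
  measurable_fun [set: R] h1 -> measurable_fun [set: R] h2 ->
  (forall x, x != 0%R -> h1 x = h2 x) -> \int[mu]_x h1 x = \int[mu]_x h2 x.
Proof.
move=> m1 m2 h12; have mD : measurable ([set: R] `\ 0%R) by exact: measurableD.
have /esym D1 := @integral_setD1 _ h1 0%R [set: R] mD (measurable_funTS m1).
have /esym D2 := @integral_setD1 _ h2 0%R [set: R] mD (measurable_funTS m2).
rewrite D1 D2; apply: eq_integral => x; rewrite inE => -[_ /eqP x0].
exact: h12.
Qed.

(* The substitution [y = x * u] followed by [x = r * cos (atan u)], with the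
   order of integration exchanged in between. *)
Lemma ge0_integral_polar (g : R * R -> \bar R) :
  measurable_fun [set: R * R] g -> (forall p, 0 <= g p) ->
  \int[mu \x mu]_p g p = \int[mu]_(r in `[0%R, +oo[) \int[mu]_u
    ((r / (1 + u ^+ 2))%R%:E * (g (r * cos (atan u), r * sin (atan u))%R +
                                g (- r * cos (atan u), - r * sin (atan u))%R)).
Proof.
move=> mg g0.
(* The integrand after [y = x * u], with Jacobian the absolute value of [x]. *)
pose f1 (p : R * R) := (`|p.1|%:E * g (p.1, p.1 * p.2)%R).
have mf1 : measurable_fun [set: R * R] f1.
  apply: emeasurable_funM.
    by apply/measurable_EFinP; apply: measurableT_comp.
  apply: measurableT_comp => //; apply: measurable_fun_pair => //.
  exact: measurable_funM.
have f10 p : 0 <= f1 p by rewrite mule_ge0.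
pose cf (u : R) : R := cos (atan u).
have mcf : measurable_fun [set: R] cf by exact: measurable_cos_atan.
have cf0 u : (0 < cf u)%R by exact: cos_atan_gt0.
(* The integrand after [x = r * cos (atan u)]: one factor [cos] comes from the previous Jacobian and
   one from the new one. *)
pose f2 (p : R * R) := (`|p.1|%:E * (cf p.2 ^+ 2)%R%:E *
  g (p.1 * cf p.2, p.1 * (p.2 * cf p.2))%R).
have mcf2 : measurable_fun [set: R * R] (fun p => cf p.2).
  by apply: measurableT_comp.
have mf2 : measurable_fun [set: R * R] f2.
  apply: emeasurable_funM.
    apply: emeasurable_funM; apply/measurable_EFinP.
      by apply: measurableT_comp.
    exact: measurable_funX.
  apply: measurableT_comp => //; apply: measurable_fun_pair => //.
    exact: measurable_funM.
  by apply: measurable_funM => //; exact: measurable_funM.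
have f20 p : 0 <= f2 p.
  by rewrite mule_ge0// mule_ge0// lee_fin sqr_ge0.
have -> : \int[mu \x mu]_p g p = \int[mu]_x \int[mu]_y g (x, y).
  exact: (fubini_tonelli1 (m1 := mu) (m2 := mu) g mg g0).
have -> : \int[mu]_x \int[mu]_y g (x, y) = \int[mu]_x \int[mu]_u f1 (x, u).
  apply: (@eq_integral_neq0 (fun x => \int[mu]_y g (x, y)) (fun x => \int[mu]_u f1 (x, u))).
  - exact: (measurable_fun_fubini_tonelli_F (m2 := mu) g mg g0).
  - exact: (measurable_fun_fubini_tonelli_F (m2 := mu) f1 mf1 f10).
  move=> x x0.
  have mgx : measurable_fun [set: R] (fun y => g (x, y)).
    by apply: measurableT_comp => //; exact: measurable_fun_pair.
  exact: (ge0_integral_scale x0 mgx).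
rewrite (fubini_tonelli (m1 := mu) (m2 := mu) f1 mf1 f10).
have -> : \int[mu]_u \int[mu]_x f1 (x, u) = \int[mu]_u \int[mu]_r f2 (r, u).
  apply: eq_integral => u _.
  have mf1u : measurable_fun [set: R] (fun x => f1 (x, u)).
    by apply: measurableT_comp => //; exact: measurable_fun_pair.
  rewrite (ge0_integral_scale (lt0r_neq0 (cf0 u)) mf1u)//.
  apply: eq_integral => r _; rewrite /f1 /f2 /= normrM gtr0_norm//.
  rewrite muleA -!EFinM; congr (_%:E * g (_, _)); ring.
(* So far [r] is signed. Folding adds the values at the opposite points, which lie in the left
   half-plane. *)
rewrite -(fubini_tonelli (m1 := mu) (m2 := mu) f2 mf2 f20) ge0_integral_fold; first last.
- by move=> r; exact: integral_ge0.
- exact: (measurable_fun_fubini_tonelli_F (m2 := mu) f2 mf2 f20).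
apply: eq_integral => r; rewrite inE /= in_itv /= andbT => r0.
have mf2r (x : R) : measurable_fun [set: R] (fun u => f2 (x, u)).
  by apply: measurableT_comp => //; exact: measurable_fun_pair.
rewrite -ge0_integralD//; [|exact: mf2r|exact: mf2r].
apply: eq_integral => u _; rewrite /f2 /= normrN ger0_norm// -EFinM sqr_cos_atan.
by rewrite !sin_atan ge0_muleDr.
Qed.

End Polar.

Section ParsevalAtan.
Variable R : realType.
Local Notation mu := (@lebesgue_measure R).

Lemma continuous_inv1Dsqr : continuous (fun u : R => (1 + u ^+ 2)^-1).
Proof.
move=> u; apply: cvgV; first by rewrite gt_eqF// ltr_pwDl// sqr_ge0.
by apply: cvgD; [exact: cvg_cst|exact: exprn_continuous].
Qed.

(** The integrand is the derivative of [F (atan u)]. Folding onto the half-line reduces to the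
    fundamental theorem on [[0, +oo[], with limit values given by [atan u --> pi / 2]. *)
Lemma integral_atan (F h : R -> R) :
  (forall t : R, is_derive t 1 F (h t)) -> continuous h -> (forall t, 0 <= h t) ->
  (\int[mu]_u (h (atan u) / (1 + u ^+ 2))%R%:E =
   (F (pi / 2) - F (- (pi / 2)))%R%:E)%E.
Proof.
move=> dF ch h0.
have ck : continuous (fun u : R => h (atan u) / (1 + u ^+ 2)).
  move=> u; apply: cvgM; last exact: continuous_inv1Dsqr.
  by apply: continuous_comp; [exact: continuous_atan|exact: ch].
have i0 (u : R) : 0 <= (1 + u ^+ 2)^-1 by rewrite invr_ge0 addr_ge0// sqr_ge0.
rewrite ge0_integral_fold; last 2 first.
- by apply/measurable_EFinP; exact: continuous_measurable_fun.
- by move=> u; rewrite lee_fin mulr_ge0.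
under eq_integral do rewrite -EFinD.
have dG (u : R) : is_derive u 1 (fun u => F (atan u) - F (atan (- u)))
    (h (atan u) / (1 + u ^+ 2) + h (atan (- u)) / (1 + (- u) ^+ 2)).
  have dN : is_derive u 1 (fun v : R => - v) (-1) by apply: is_derive_eq.
  have d1 := is_derive1_comp (dF (atan u)) (is_derive1_atan u).
  have d2 := is_derive1_comp (dF (atan (- u)))
    (is_derive1_comp (is_derive1_atan (- u)) dN).
  by apply: is_derive_eq (is_deriveB d1 d2) _; ring.
have derivable_cont (k dk : R -> R) :
    (forall t : R, is_derive t 1 k (dk t)) -> continuous k.
  move=> d t; apply: differentiable_continuous; apply/derivable1_diffP.
  by have [] := d t.
have cF := derivable_cont _ _ dF; have cG := derivable_cont _ _ dG.
rewrite (@ge0_continuous_FTC2y _ _ (fun u => F (atan u) - F (atan (- u))) 0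
    (F (pi / 2) - F (- (pi / 2)))).
- by rewrite oppr0 subrr sube0.
- by move=> u _; rewrite addr_ge0// mulr_ge0.
- apply: continuous_subspaceT => u; apply: cvgD; first exact: ck.
  apply: (@continuous_comp _ _ _ (fun v : R => - v)
    (fun v : R => h (atan v) / (1 + v ^+ 2))); first exact: opp_continuous.
  exact: (ck (- u)).
- apply: cvgB.
    by apply: (cvg_comp (@atan R) F (@cvgy_atan R)); exact: (cF (pi / 2)).
  under eq_cvg do rewrite atanN.
  apply: (cvg_comp (fun u => - atan u) F); last exact: (cF (- (pi / 2))).
  by apply: cvgN; exact: cvgy_atan.
- by move=> u _; have [] := dG u.
- by apply: cvg_at_right_filter; exact: (cG 0).
- by move=> u _; rewrite derive1E; have [_ ->] := dG u.
Qed.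

(* [atan u] and [atan u + pi] range over the two halves of the circle. *)
Lemma integral_sqr_cmod_partial_atan (b : nat -> R[i]) N :
  (\int[mu]_u
    ((cmod (\sum_(n < N) b n * cis (atan u) ^+ n) ^+ 2 +
      cmod (\sum_(n < N) b n * cis (atan u + pi) ^+ n) ^+ 2) / (1 + u ^+ 2))%R%:E =
   (2 * pi * \sum_(n < N) cmod (b n) ^+ 2)%R%:E)%E.
Proof.
have [F [dF pF]] := sqr_cmod_antiderivative b N.
set S := fun t => cmod (\sum_(n < N) b n * cis t ^+ n) ^+ 2.
have cS : continuous S by apply: ccont_sqr_cmod; exact/ccont_poly/ccont_cis.
have dFF (t : R) : is_derive t 1 (fun t => F t + F (t + pi)) (S t + S (t + pi)).
  have dD : is_derive t 1 (fun s : R => s + pi) 1 by apply: is_derive_eq; ring.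
  have := @is_derive1_comp R F (fun s => s + pi) t _ _ (dF (t + pi)) dD.
  have := dF t => ? ?.
  by apply: is_derive_eq; rewrite mulr1.
rewrite (integral_atan dFF).
(* The two values at [pi / 2] cancel, leaving the increment of [F] over the full period from
   [- pi / 2] to [3 * pi / 2]. *)
- congr EFin; have := pF (- (pi / 2)); rewrite (_ : - (pi / 2) + 2 * pi = pi / 2 + pi).
    by rewrite (_ : - (pi / 2) + pi = pi / 2); [move=> ->; ring|field].
  by field.
- move=> t; apply: cvgD; first exact: cS.
  apply: (@continuous_comp _ _ _ (fun s : R => s + pi) S); last exact: (cS (t + pi)).
  by apply: cvgD; [exact: cvg_id|exact: cvg_cst].
- by move=> t; rewrite addr_ge0 ?sqr_ge0.
Qed.

(** As in [parseval], but dominated by a multiple of [1 / (1 + u ^+ 2)], since nonzero constants are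
    not integrable on the line. *)
Lemma parseval_atan (b : nat -> R[i]) (B : R) (g : R -> R[i]) :
  cvgn (psum (fun n => cmod (b n))) ->
  psum (fun n => cmod (b n) ^+ 2) @ \oo --> B ->
  (forall t, csum (fun n => b n * cis t ^+ n) (g t)) ->
  (\int[mu]_u ((cmod (g (atan u)) ^+ 2 + cmod (g (atan u + pi)) ^+ 2) /
      (1 + u ^+ 2))%R%:E = (2 * pi * B)%R%:E)%E.
Proof.
move=> /cvg_ex[/= M cM] cB bg.
have b0 n : 0 <= cmod (b n) by exact: cmod_ge0.
pose S N t := cmod (\sum_(n < N) b n * cis t ^+ n) ^+ 2.
have SM N t : S N t <= M ^+ 2.
  rewrite /S lerXn2r ?nnegrE ?cmod_ge0//.
    by have := psum_le b0 cM 0; rewrite big_ord0.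
  apply: le_trans (cmod_sum _ _ _) (le_trans _ (psum_le b0 cM N)).
  by apply: ler_sum => i _; rewrite cmodM cmodX cmod_cis expr1n mulr1.
have cS N : continuous (S N).
  by apply: ccont_sqr_cmod; exact/ccont_poly/ccont_cis.
have i0 (u : R) : 0 <= (1 + u ^+ 2)^-1 by rewrite invr_ge0 addr_ge0// sqr_ge0.
pose f N (u : R) := ((S N (atan u) + S N (atan u + pi)) / (1 + u ^+ 2))%:E.
pose dom (u : R) := ((M ^+ 2 + M ^+ 2) / (1 + u ^+ 2))%:E.
have := @dominated_cvg _ _ _ mu setT measurableT f
  (fun u => ((cmod (g (atan u)) ^+ 2 + cmod (g (atan u + pi)) ^+ 2) /
      (1 + u ^+ 2))%:E) dom.
have -> : (fun n => \int[mu]_u f n u)%E =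
    EFin \o (fun n => 2 * pi * \sum_(i < n) cmod (b i) ^+ 2).
  by apply/funext => n; rewrite integral_sqr_cmod_partial_atan.
move=> h; apply: (cvg_unique _ (h _ _ _ _ _)) => {h} //.
- move=> N; apply/measurable_EFinP; apply: continuous_measurable_fun => u.
  apply: cvgM; last exact: continuous_inv1Dsqr.
  apply: cvgD.
    apply: (@continuous_comp _ _ _ (@atan R) (S N)); first exact: continuous_atan.
    exact: (cS N (atan u)).
  apply: (@continuous_comp _ _ _ (fun u => atan u + pi) (S N)).
    by apply: cvgD; [exact: continuous_atan|exact: cvg_cst].
  exact: (cS N (atan u + pi)).
- move=> u _; apply/cvg_EFin; first exact: nearW.
  apply: cvgM; last exact: cvg_cst.
  by apply: cvgD; [exact: (csum_cvg_sqr_cmod (bg _))|exact: (csum_cvg_sqr_cmod (bg _))].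
- have mdom : measurable_fun [set: R] (fun u : R => (M ^+ 2 + M ^+ 2) / (1 + u ^+ 2)).
    apply: continuous_measurable_fun => u; apply: cvgM; first exact: cvg_cst.
    exact: continuous_inv1Dsqr.
  apply/integrableP; split; first exact/measurable_EFinP.
  under eq_integral => u _ do rewrite /dom /= ger0_norm ?mulr_ge0 ?addr_ge0 ?sqr_ge0//.
  have dlin (t : R) : is_derive t 1 (fun t => t * (M ^+ 2 + M ^+ 2)) (M ^+ 2 + M ^+ 2).
    by apply: is_derive_eq; rewrite /GRing.scale /=; ring.
  rewrite (integral_atan dlin).
  + exact: ltry.
  + by move=> t; exact: cvg_cst.
  + by move=> t; rewrite addr_ge0 ?sqr_ge0.
- move=> N u _; rewrite /f /dom /= lee_fin ger0_norm.
    by rewrite ler_wpM2r// lerD.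
  by rewrite mulr_ge0// addr_ge0 ?sqr_ge0.
- apply/cvg_EFin; first exact: nearW.
  by apply: cvgM => //; exact: cvg_cst.
Qed.

End ParsevalAtan.

(** * The radial beta integral *)

Section Beta.
Variable R : realType.
Local Notation mu := (@lebesgue_measure R).

(** The integrand may blow up at 1, as the radial weight does for [al < 2]; hence an exhaustion by
    compact intervals and monotone convergence. *)
Lemma ge0_FTC2_01 (h F : R -> R) (l : R) :
  (forall r, 0 <= r < 1 -> 0 <= h r) ->
  (forall r, 0 <= r < 1 -> {for r, continuous h}) ->
  (forall r : R, 0 <= r < 1 -> is_derive r 1 F (h r)) ->
  F r @[r --> 1^'-] --> l ->
  (\int[mu]_(r in `[0%R, 1%R[) (h r)%:E = (l - F 0)%:E)%E.
Proof.
move=> h0 ch dF F1.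
pose x (n : nat) : R := 1 - n.+2%:R^-1.
have x0 n : 0 < x n by rewrite /x subr_gt0 invf_lt1// ltr1n.
have x1 n : x n < 1 by rewrite /x gtrBl.
have cx : x @ \oo --> (1 : R).
  rewrite -[X in _ --> X]subr0; apply: cvgB; first exact: cvg_cst.
  have := @cvg_harmonic R; rewrite -cvg_shiftS; exact.
have cFx : F (x n) @[n --> \oo] --> l by move/cvg_at_leftP: F1; apply.
have ndx : {homo x : n m / (n <= m)%N >-> n <= m}.
  by move=> n m nm; rewrite /x lerD2l lerN2 lef_pV2 ?posrE// ler_nat.
have UE : \bigcup_n `[0, x n]%classic = `[0, 1[%classic.
  apply/seteqP; split => [r [n _]|r] /=; rewrite !in_itv /= => /andP[r0 r1].
    by rewrite r0 (le_lt_trans r1).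
  near \oo => n; exists n => //=; rewrite in_itv /= r0 /=.
  by apply: ltW; near: n; apply: (cvgr_gt _ cx).
have sub n r : r \in `[0, x n] -> 0 <= r < 1.
  by rewrite in_itv /= => /andP[-> /le_lt_trans]; apply.
have chn n : {within `[0, x n]%classic, continuous h}.
  by apply: continuous_in_subspaceT => r; rewrite inE => /sub; exact: ch.
have In n : (\int[mu]_(r in `[0%R, x n]) (h r)%:E = (F (x n) - F 0)%:E)%E.
  have cF r : 0 <= r < 1 -> {for r, continuous F}.
    move=> r01; apply: differentiable_continuous; apply/derivable1_diffP.
    by have [] := dF r r01.
  rewrite (@continuous_FTC2 _ _ F)// ?EFinB//.
    split.
    - move=> r /subset_itv_oo_cc/sub r01.
      by have [] := dF r r01.
    - by apply: cvg_at_right_filter; apply: cF; rewrite lexx ltr01.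
    - by apply: cvg_at_left_filter; apply: cF; rewrite x1 ltW.
  move=> r /subset_itv_oo_cc/sub r01.
  by rewrite derive1E; have [_ ->] := dF r r01.
have := @ge0_nondecreasing_set_cvg_integral _ (measurableTypeR R) R
  (fun n => `[0, x n]%classic) (EFin \o h) mu.
rewrite UE.
rewrite (_ : (fun i => \int[mu]_(r in `[0%R, x i]) (EFin \o h) r)%E =
  EFin \o (fun n => F (x n) - F 0)); last by apply/funext => n; exact: In.
move=> H; apply: (cvg_unique _ (H _ _ _ _)) => {H} //.
- move=> n m nm; apply/subsetPset => r /=; rewrite !in_itv /= => /andP[-> /=].
  by move=> /le_trans; apply; exact: ndx.
- move=> n; apply/measurable_EFinP; exact: subspace_continuous_measurable_fun.
- by move=> n r /sub; rewrite lee_fin; exact: h0.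
apply/cvg_EFin; first exact: nearW.
by apply: cvgB => //; exact: cvg_cst.
Unshelve. all: by end_near. Qed.

Lemma cvg_powR_1sqr (p : R) : 0 < p ->
  (1 - r ^+ 2) `^ p @[r --> 1^'-] --> (0 : R).
Proof.
move=> p0; apply: (@cvg_comp _ _ _ (fun r : R => 1 - r ^+ 2) (fun x => x `^ p)
  _ (0 : R)^'+); last exact: powR_cvg0.
have q0 : 1 - r ^+ 2 @[r --> (1 : R)^'-] --> (0 : R).
  apply: cvg_at_left_filter; rewrite (_ : 0 = 1 - 1 ^+ 2 :> R); last by rewrite expr1n subrr.
  by apply: cvgB; [exact: cvg_cst|exact: exprn_continuous].
move=> A /= [e /= e0 eA]; near=> r; apply: eA => /=.
  by near: r; move/cvgrPdist_lt: q0 => /(_ e e0).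
rewrite subr_gt0 exprn_ilt1//.
by near: r; apply: nbhs_left_ge; exact: ltr01.
Unshelve. all: by end_near. Qed.

(** Repeated integration by parts, carried out on antiderivatives normalized to vanish at 1, so that
    the value at 0 is minus the integral. *)
Lemma beta_antiderivative (al : R) n : 1 < al -> exists F : R -> R,
  [/\ forall r : R, 0 <= r < 1 -> is_derive r 1 F
        (2 * r ^+ (2 * n).+1 * ((al - 1) * (1 - r ^+ 2) `^ (al - 2))),
      F r @[r --> 1^'-] --> (0 : R) & F 0 = - (cbin al n)^-1].
Proof.
move=> al1; have q0 (r : R) : 0 <= r < 1 -> 0 < 1 - r ^+ 2.
  by move=> /andP[r0 r1]; rewrite subr_gt0 exprn_ilt1.
have dq (r : R) : is_derive r 1 (fun s : R => 1 - s ^+ 2) (- (2 * r)).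
  apply: is_derive_eq; rewrite /GRing.scale /=; ring.
have dp (r : R) : 0 <= r < 1 -> is_derive r 1 (fun s : R => (1 - s ^+ 2) `^ (al - 1))
    (- (2 * r * ((al - 1) * (1 - r ^+ 2) `^ (al - 2)))).
  move=> /q0 q0r; have := @is_derive1_comp R (fun x => x `^ (al - 1))
    (fun s => 1 - s ^+ 2) r _ _ (is_derive1_powR (al - 1) q0r) (dq r).
  move=> d; apply: is_derive_eq d _.
  by rewrite (_ : al - 1 - 1 = al - 2); ring.
have cp : (1 - r ^+ 2) `^ (al - 1) @[r --> 1^'-] --> (0 : R).
  by apply: cvg_powR_1sqr; rewrite subr_gt0.
have dX m (r : R) : is_derive r 1 (fun s : R => s ^+ m) (m%:R * r ^+ m.-1).
  have -> : (fun s : R => s ^+ m) = (id : R -> R) ^+ m by rewrite exprfctE.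
  apply: is_derive_eq (is_deriveX m (is_derive_id r 1)) _.
  by rewrite /GRing.scale /= mulr1.
elim: n => [|n [F [dF F1 F0]]].
  exists (fun r => - (1 - r ^+ 2) `^ (al - 1)); split.
  - move=> r r01; have := dp r r01 => d; apply: is_derive_eq.
    by rewrite muln0 expr1; ring.
  - by rewrite -[X in _ --> X]oppr0; exact: cvgN.
  - by rewrite expr0n subr0 powR1 cbin0 invr1.
have aln0 : al + n%:R != 0.
  by rewrite gt_eqF// ltr_wpDr// (lt_trans ltr01).
(* The factor [(n + 1) / (al + n)] is the recurrence [cbinS] for the inverse of [cbin al n]; the
   subtracted term vanishes at both ends. *)
exists (fun r => (n.+1%:R * F r - (al - 1) * (r ^+ (2 * n.+1) * (1 - r ^+ 2) `^ (al - 1)))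
  / (al + n%:R)); split.
- move=> r r01; have := dp r r01 => ?; have := dF r r01 => ?.
  have := dX (2 * n.+1)%N r; rewrite (_ : (2 * n.+1).-1 = (2 * n).+1)%N => [?|]; last by rewrite mulnS.
  apply: is_derive_eq; rewrite /GRing.scale /=.
  have -> : (1 - r ^+ 2) `^ (al - 1) = (1 - r ^+ 2) * (1 - r ^+ 2) `^ (al - 2).
    have q0r := ltW (q0 r r01); have al10 : 0 < al - 1 by rewrite subr_gt0.
    rewrite -(mulr_powRB1 q0r al10) (_ : al - 1 - 1 = al - 2)//.
    by rewrite -addrA -opprD.
  have e2 : (2 * n).+2%:R = 2 * (n%:R + 1) :> R by rewrite -!natr1 natrM; ring.
  rewrite !mulnS !add2n e2 !exprS -(natr1 n).
  by field.
- rewrite (_ : 0 = (n.+1%:R * 0 - (al - 1) * (1 ^+ (2 * n.+1) * 0)) / (al + n%:R)) ; last by rewrite !mulr0 subrr mul0r.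
  apply: cvgM; last exact: cvg_cst.
  apply: cvgB; first by apply: cvgM => //; exact: cvg_cst.
  apply: cvgM; first exact: cvg_cst.
  apply: cvgM => //; apply: cvg_at_left_filter; exact: exprn_continuous.
- rewrite F0 mulnS expr0n /= mul0r mulr0 subr0.
  have c0 : cbin al n != 0 by rewrite gt_eqF// cbin_gt0// (lt_trans ltr01).
  have c1 : cbin al n.+1 != 0 by rewrite gt_eqF// cbin_gt0// (lt_trans ltr01).
  apply: (mulfI c1); rewrite [RHS]mulrN divff//.
  have n1 : n.+1%:R != 0 :> R by rewrite pnatr_eq0.
  have -> : cbin al n.+1 = (al + n%:R) * cbin al n / n.+1%:R.
    by rewrite -cbinS mulrAC mulfV// mul1r.
  by field; rewrite aln0 c0 nat1r n1.
Qed.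

Lemma beta_integral (al : R) n : 1 < al ->
  (\int[mu]_(r in `[0%R, 1%R[)
    (2 * r ^+ (2 * n).+1 * ((al - 1) * (1 - r ^+ 2) `^ (al - 2)))%:E =
   ((cbin al n)^-1)%:E)%E.
Proof.
move=> al1; have [F [dF F1 F0]] := beta_antiderivative n al1.
rewrite (ge0_FTC2_01 _ _ dF F1) ?F0 ?sub0r ?opprK//.
- move=> r /andP[r0 _]; rewrite !mulr_ge0 ?exprn_ge0 ?powR_ge0//.
  by rewrite subr_ge0 ltW.
- move=> r /andP[r0 r1].
  have q0 : 0 < 1 - r ^+ 2 by rewrite subr_gt0 exprn_ilt1.
  apply: cvgM; first by apply: cvgM; [exact: cvg_cst|exact: exprn_continuous].
  apply: cvgM; first exact: cvg_cst.
  apply: (@continuous_comp _ _ _ (fun r : R => 1 - r ^+ 2) (fun x => x `^ (al - 2))).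
    by apply: cvgB; [exact: cvg_cst|exact: exprn_continuous].
  apply: differentiable_continuous; apply/derivable1_diffP.
  by have [] := is_derive1_powR (al - 2) q0.
Qed.

End Beta.

(** * The Bergman norm as a coefficient sum *)

Section Bergman.
Variable R : realType.
Local Notation mu := (@lebesgue_measure R).
Implicit Types (f : R[i] -> R[i]) (a : nat -> R[i]).

Lemma nneseries_psum (x : nat -> R) (B : R) : psum x @ \oo --> B ->
  (\sum_(n <oo) (x n)%:E = B%:E)%E.
Proof.
move=> cx; apply/cvg_lim => //.
rewrite (_ : (fun n => _) = EFin \o (fun n => \sum_(i < n) x i)).
  by apply/cvg_EFin; [exact: nearW|exact: cx].
by apply/funext => n; rewrite /= big_mkord sumEFin.
Qed.

Definition complex_of (p : R * R) : R[i] := p.1 +i* p.2.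

Definition sqr_radius (p : R * R) : R := p.1 ^+ 2 + p.2 ^+ 2.

Lemma sqr_cmod_complex_of p : cmod (complex_of p) ^+ 2 = sqr_radius p.
Proof. by rewrite sqr_cmod. Qed.

Lemma disc_complex_of p : disc (complex_of p) <-> sqr_radius p < 1.
Proof.
rewrite -sqr_cmod_complex_of /disc /=; split=> h; first by rewrite exprn_ilt1 ?cmod_ge0.
by rewrite -(@ltr_pXn2r _ 2)// ?nnegrE ?cmod_ge0// expr1n.
Qed.

Definition plane_disc : set (R * R) := [set p | disc (complex_of p)].

Lemma measurable_sqr_radius : measurable_fun [set: R * R] sqr_radius.
Proof. by apply: measurable_funD; apply: measurable_funX. Qed.

Lemma measurable_plane_disc : measurable plane_disc.
Proof.
rewrite (_ : plane_disc = sqr_radius @^-1` `]-oo, 1[%classic).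
  by rewrite -[X in measurable X]setTI; apply: measurable_sqr_radius.
by apply/seteqP; split => p; have [h1 h2] := disc_complex_of p; rewrite /= in_itv.
Qed.

(** The density in terms of the squared modulus [t], with the powers [al] and [-2] of [1 - t]
    merged. *)
Definition weight (al t : R) : R := (al - 1) * (1 - t) `^ (al - 2) / pi.

Lemma weight_ge0 al t : 1 < al -> 0 <= weight al t.
Proof.
move=> al1; rewrite /weight divr_ge0 ?pi_ge0// mulr_ge0 ?powR_ge0//.
by rewrite subr_ge0 ltW.
Qed.

Lemma bergman_integrand al (c : R) p : plane_disc p -> 0 <= c ->
  c `^ 2 * ((al - 1) * (1 - cmod (complex_of p) ^+ 2) `^ al) *
    ((1 - cmod (complex_of p) ^+ 2) ^- 2 / pi) = c ^+ 2 * weight al (sqr_radius p).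
Proof.
move=> /disc_complex_of q1 c0; rewrite sqr_cmod_complex_of powR_mulrn// /weight.
have t0 : 0 < 1 - sqr_radius p by rewrite subr_gt0.
rewrite powRB; last by rewrite (gt_eqF t0) implybT.
by rewrite powR_mulrn ?ltW//; ring.
Qed.

(** Opposite points have the same squared radius, so the indicator of the disc only cuts the radial
    range down to [r < 1]. *)
Lemma ge0_integral_plane_disc (h : R * R -> R) : (forall p, 0 <= h p) ->
  measurable_fun plane_disc h ->
  (\int[mu \x mu]_(p in plane_disc) (h p)%:E =
   \int[mu]_(r in `[0%R, 1%R[) \int[mu]_u
     (r / (1 + u ^+ 2) * (h (r * cos (atan u), r * sin (atan u)) +
        h (- r * cos (atan u), - r * sin (atan u))))%:E)%E.
Proof.
move=> h0 mh; rewrite integral_mkcond ge0_integral_polar.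
- rewrite [LHS]integral_mkcond [RHS]integral_mkcond; apply: eq_integral => r _.
  have qE (s u : R) : sqr_radius (s * cos (atan u), s * sin (atan u)) = s ^+ 2.
    by rewrite /sqr_radius /= !exprMn -mulrDr cos2Dsin2 mulr1.
  rewrite !patchE; case: ifPn => [|rN]; last first.
    case: ifPn => //; rewrite inE /= in_itv /= => /andP[r0 r1].
    by move: rN; rewrite mem_set//= in_itv /= r0.
  rewrite inE /= in_itv /= andbT => r0.
  case: ifPn => [|r1].
    rewrite inE /= in_itv /= => /andP[_ r1]; apply: eq_integral => u _.
    have r21 : r ^+ 2 < 1 by rewrite exprn_ilt1.
    rewrite !patchE !mem_set; last 2 first.
    + by apply/disc_complex_of; rewrite qE sqrrN.
    + by apply/disc_complex_of; rewrite qE.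
    by rewrite /= -EFinD -EFinM.
  rewrite integral0_eq// => u _.
  have r2 : ~ (r ^+ 2 < 1).
    move=> r21; move/negP: r1; apply; rewrite inE /= in_itv /= r0 /=.
    by rewrite -(@ltr_pXn2r _ 2)// ?nnegrE// expr1n.
  rewrite !patchE !memNset ?adde0 ?mule0//.
  + by move=> /disc_complex_of; rewrite qE sqrrN.
  + by move=> /disc_complex_of; rewrite qE.
- by apply/(measurable_restrictT _ measurable_plane_disc); exact/measurable_EFinP.
- by move=> p; rewrite patchE; case: ifP => // _; rewrite lee_fin.
Qed.

Lemma measurable_weight al : measurable_fun [set: R * R] (fun p => weight al (sqr_radius p)).
Proof.
apply: measurable_funM => //; apply: measurable_funM => //.
apply: (measurableT_comp (measurable_powR (al - 2))).
by apply: measurable_funB => //; exact: measurable_sqr_radius.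
Qed.

Lemma measurable_bergman_integrand f a al : represents f a ->
  measurable_fun plane_disc (fun p => cmod (f (complex_of p)) ^+ 2 * weight al (sqr_radius p)).
Proof.
move=> fa; apply: measurable_funM; last first.
  by apply: measurable_funTS; exact: measurable_weight.
apply: (measurable_sqr_cmod_represents fa); last by [].
by split; apply: measurable_funTS; [exact: measurable_fst|exact: measurable_snd].
Qed.

(** The [pi] of the weight cancels the [2 * pi] of Parseval and leaves the factor 2 of the beta
    integrand. The value is kept as an extended real series, ready to be exchanged with the radial
    integral. *)
Lemma angular_integral f a al (r : R) : 1 < al -> represents f a -> 0 <= r < 1 ->
  (\int[mu]_u (r / (1 + u ^+ 2) *
     (cmod (f (r * cos (atan u) +i* (r * sin (atan u)))) ^+ 2 * weight al (r ^+ 2) +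
      cmod (f (- r * cos (atan u) +i* (- r * sin (atan u)))) ^+ 2 * weight al (r ^+ 2)))%:E =
   \sum_(n <oo) (2 * r ^+ (2 * n).+1 * ((al - 1) * (1 - r ^+ 2) `^ (al - 2)) *
     cmod (a n) ^+ 2)%:E)%E.
Proof.
move=> al1 fa r01; have /andP[r0 r1] := r01.
have [B cB] := represents_sqr_summable fa r01.
pose C := 2 * r * ((al - 1) * (1 - r ^+ 2) `^ (al - 2)).
rewrite (_ : (\sum_(n <oo) _)%E = (C * B)%:E); last first.
  apply: nneseries_psum.
  rewrite (_ : (fun N => _) = (fun N => C * \sum_(i < N) cmod (a i) ^+ 2 * r ^+ (2 * i))).
    by apply: cvgM => //; exact: cvg_cst.
  apply/funext => N; rewrite mulr_sumr; apply: eq_bigr => i _.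
  by rewrite /C exprS; ring.
pose g t := f (r%:C * cis t).
have gE t : cmod (g t) = cmod (f (r * cos t +i* (r * sin t))).
  by rewrite /g /cis; congr (cmod (f _)); simpc.
have gNE t : cmod (g (t + pi)) = cmod (f (- r * cos t +i* (- r * sin t))).
  by rewrite gE cosDpi sinDpi !mulrN !mulNr.
have bg t : csum (fun n => a n * r%:C ^+ n * cis t ^+ n) (g t).
  have : cmod (r%:C * cis t) < 1.
    by rewrite cmodM cmodC cmod_cis mulr1 ger0_norm.
  move=> /fa; rewrite (_ : (fun n => _) = (fun n => a n * r%:C ^+ n * cis t ^+ n))//.
  by apply/funext => n; rewrite exprMn mulrA.
have cb : psum (fun n => cmod (a n * r%:C ^+ n) ^+ 2) @ \oo --> B.
  by rewrite (eq_psum (fun n => sqr_cmod_powers a r n)).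
have P := @parseval_atan R (fun n => a n * r%:C ^+ n) B g
  (represents_abs_cvg fa r01) cb bg.
have w0 : 0 <= r * weight al (r ^+ 2) by rewrite mulr_ge0// weight_ge0.
transitivity ((r * weight al (r ^+ 2))%:E * \int[mu]_u
  ((cmod (g (atan u)) ^+ 2 + cmod (g (atan u + pi)) ^+ 2) / (1 + u ^+ 2))%:E)%E.
  rewrite -ge0_integralZl//.
  - apply: eq_integral => u _; rewrite -EFinM gNE gE; congr EFin; ring.
  - apply/measurable_EFinP; apply: measurable_funM; last first.
      by apply: continuous_measurable_fun; exact: continuous_inv1Dsqr.
    have mg (c : R) : measurable_fun [set: R] (fun u => cmod (g (atan u + c)) ^+ 2).
      apply: (measurable_sqr_cmod_represents fa) => [|u _]; last first.
        by rewrite cmodM cmodC cmod_cis mulr1 ger0_norm.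
      have cac : continuous (fun u : R => atan u + c).
        by move=> u; apply: cvgD; [exact: continuous_atan|exact: cvg_cst].
      apply: cmeasM; first exact: cmeas_cst.
      split; apply: continuous_measurable_fun => u.
        apply: (@continuous_comp _ _ _ (fun u => atan u + c) (@cos R)).
          exact: cac.
        exact: continuous_cos.
      apply: (@continuous_comp _ _ _ (fun u => atan u + c) (@sin R)).
        exact: cac.
      exact: continuous_sin.
    apply: measurable_funD; last exact: mg.
    by have := mg 0; under eq_fun do rewrite addr0.
  - move=> u _; rewrite lee_fin divr_ge0// ?addr_ge0 ?sqr_ge0//.
rewrite P -EFinM; congr EFin; rewrite /C /weight.
have pi0 : pi != 0 :> R by rewrite gt_eqF// pi_gt0.
by move: (pi : R) pi0 => p p0; field.
Qed.

(** All terms are nonnegative, so sum and integral are exchanged in the extended reals even when the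
    value is infinite; this is why a finite norm implies convergence. *)
Lemma bergman_integral f a al : 1 < al -> represents f a ->
  (\int[mu \x mu]_(p in plane_disc) (cmod (f (complex_of p)) ^+ 2 * weight al (sqr_radius p))%:E =
   \sum_(n <oo) (wsq al a n)%:E)%E.
Proof.
move=> al1 fa; have al0 : 0 < al by rewrite (lt_trans ltr01).
rewrite ge0_integral_plane_disc; last 2 first.
- by move=> p; rewrite mulr_ge0 ?sqr_ge0// weight_ge0.
- exact: measurable_bergman_integrand fa.
transitivity (\int[mu]_(r in `[0%R, 1%R[) \sum_(n <oo) (2 * r ^+ (2 * n).+1 *
    ((al - 1) * (1 - r ^+ 2) `^ (al - 2)) * cmod (a n) ^+ 2)%:E)%E.
  apply: eq_integral => r; rewrite inE /= in_itv /= => r01.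
  rewrite -(angular_integral al1 fa r01); apply: eq_integral => u _.
  have qE (s : R) : sqr_radius (s * cos (atan u), s * sin (atan u)) = s ^+ 2.
    by rewrite /sqr_radius /= !exprMn -mulrDr cos2Dsin2 mulr1.
  by rewrite !qE sqrrN.
have b0 n (r : R) : 0 <= r < 1 ->
    0 <= 2 * r ^+ (2 * n).+1 * ((al - 1) * (1 - r ^+ 2) `^ (al - 2)).
  move=> /andP[r0 _]; rewrite !mulr_ge0 ?exprn_ge0 ?powR_ge0//.
  by rewrite subr_ge0 ltW.
have mb n : measurable_fun (`[0%R, 1%R[%classic : set R) (fun r : R =>
    2 * r ^+ (2 * n).+1 * ((al - 1) * (1 - r ^+ 2) `^ (al - 2))).
  apply: measurable_funTS; apply: measurable_funM.
    by apply: measurable_funM => //; exact: measurable_funX.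
  apply: measurable_funM => //; apply: (measurableT_comp (measurable_powR (al - 2))).
  by apply: measurable_funB => //; exact: measurable_funX.
rewrite integral_nneseries//; last 2 first.
- by move=> n; apply/measurable_EFinP; apply: measurable_funM => //; exact: mb.
- move=> n r; rewrite /= in_itv /= => r01; rewrite lee_fin mulr_ge0 ?sqr_ge0//.
  exact: b0.
apply: eq_eseriesr => n _.
transitivity ((cmod (a n) ^+ 2)%:E * \int[mu]_(r in `[0%R, 1%R[)
    (2 * r ^+ (2 * n).+1 * ((al - 1) * (1 - r ^+ 2) `^ (al - 2)))%:E)%E.
  rewrite -ge0_integralZl//.
  - by apply: eq_integral => r _; rewrite -EFinM mulrC.
  - by apply/measurable_EFinP; exact: mb.
  - by move=> r; rewrite /= in_itv /= => r01; rewrite lee_fin b0.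
  - by rewrite lee_fin sqr_ge0.
by rewrite beta_integral// -EFinM.
Qed.

Lemma bergman_normE f a al : 1 < al -> represents f a ->
  bergman_norm 2 al f = ((\sum_(n <oo) (wsq al a n)%:E) `^ 2^-1)%E.
Proof.
move=> al1 fa; rewrite -(bergman_integral al1 fa) /bergman_norm; congr poweR.
apply: eq_integral => p; rewrite inE => pD; congr EFin.
by rewrite -(bergman_integrand al) ?cmod_ge0.
Qed.

Lemma bergman_norm_sqnorm f a al X : 1 < al -> represents f a ->
  sqnorm al a X -> bergman_norm 2 al f = (X `^ 2^-1)%:E.
Proof.
by move=> al1 fa aX; rewrite (bergman_normE al1 fa) (nneseries_psum aX) poweR_EFin.
Qed.

Lemma bergman_norm_fin f a al : 1 < al -> represents f a ->
  (bergman_norm 2 al f < +oo)%E -> exists X, sqnorm al a X.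
Proof.
move=> al1 fa; have al0 : 0 < al by rewrite (lt_trans ltr01).
have w0 n : 0 <= wsq al a n by exact: wsq_ge0.
rewrite (bergman_normE al1 fa) => fin.
have : (\sum_(n <oo) (wsq al a n)%:E < +oo)%E.
  by apply: lty_poweRy fin; rewrite invr_eq0.
set S := (\sum_(n <oo) _)%E => Soo.
have S0 : (0 <= S)%E by apply: nneseries_ge0 => n _ _; rewrite lee_fin.
have Sfin : S \is a fin_num by rewrite ge0_fin_numE.
have [||X cX _] := @psum_bounded _ (wsq al a) (fine S) => //.
  move=> N; rewrite -lee_fin fineK// -sumEFin -(big_mkord xpredT (fun i => (wsq al a i)%:E)).
  by apply: nneseries_lim_ge => n _; rewrite lee_fin.
by exists X.
Qed.

End Bergman.

(** * From functions to coefficients and back *)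

Section Spaces.
Variable R : realType.
Implicit Types (f : R[i] -> R[i]) (a : nat -> R[i]) (al X : R).

Lemma csum_errorD a b s t : csum a s -> csum b t ->
  (fun n => cmod (s - \sum_(m < n) a m) + cmod (t - \sum_(m < n) b m)) @ \oo
    --> (0 : R).
Proof. by move=> sa tb; rewrite -[X in _ --> X]addr0; exact: cvgD. Qed.

Lemma csum_unique a s t : csum a s -> csum a t -> s = t.
Proof.
move=> sa ta; apply/eqP; rewrite -subr_eq0 -cmod_eq0; apply/eqP.
have : (fun _ : nat => cmod (s - t)) @ \oo --> (0 : R).
  apply: cvg0_le (csum_errorD sa ta) => n.
  rewrite cmod_ge0 /=.
  rewrite (_ : s - t = (s - \sum_(m < n) a m) - (t - \sum_(m < n) a m)); last by ring.
  by apply: le_trans (cmodD _ _) _; rewrite cmodN.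
by move=> c0; apply: (cvg_unique _ (cvg_cst (cmod (s - t))) c0).
Qed.

Lemma csum_finite a N : (forall n, (N <= n)%N -> a n = 0) ->
  csum a (\sum_(n < N) a n).
Proof.
move=> aN; have E n : (N <= n)%N -> \sum_(m < n) a m = \sum_(m < N) a m.
  move=> Nn; rewrite -!(big_mkord xpredT) (@big_cat_nat _ _ _ N 0 n)//=.
  rewrite [X in _ + X]big_nat_cond [X in _ + X]big1 ?addr0// => i /andP[/andP[Ni _] _].
  exact: aN.
apply: (@cvg_trans _ ((fun=> 0 : R) @ \oo)); last exact: cvg_cst.
apply: near_eq_cvg; near=> n; rewrite E ?subrr ?cmod0//.
by near: n; exists N.
Unshelve. all: by end_near. Qed.

Lemma csumB a b s t : csum a s -> csum b t -> csum (fun n => a n - b n) (s - t).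
Proof.
move=> sa tb; apply: cvg0_le (csum_errorD sa tb) => n.
rewrite cmod_ge0 /= sumrB.
rewrite (_ : s - t - _ = (s - \sum_(m < n) a m) - (t - \sum_(m < n) b m)); last by ring.
by apply: le_trans (cmodD _ _) _; rewrite cmodN.
Qed.

Lemma csum_bigprod k (f : 'I_k -> R[i] -> R[i]) (c : 'I_k -> nat -> R[i]) (r : R) :
  (forall j z, cmod z < r -> csum (fun n => c j n * z ^+ n) (f j z)) ->
  forall z, cmod z < r ->
    csum (fun n => cauchy_bigprod c n * z ^+ n) (\prod_(j < k) f j z).
Proof.
elim: k f c => [|k ih] f c fc z zr.
  rewrite big_ord0 /cauchy_bigprod big_ord0.
  have := @csum_finite (fun n => unit_seq R[i] n * z ^+ n) 1.
  rewrite big_ord1 /unit_seq eqxx expr0 mulr1; apply => n n0.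
  by rewrite gtn_eqF// mul0r.
rewrite big_ord_recl cauchy_bigprodS.
have ih' := ih (f \o lift ord0) (c \o lift ord0) (fun j => fc (lift ord0 j)).
apply: (@csum_cauchy_prod_powers _ _ _ r) => //.
- by move=> w wr; exists (f ord0 w); exact: fc.
- by move=> w wr; exists (\prod_(j < k) f (lift ord0 j) w); exact: ih'.
- exact: fc.
- exact: ih'.
Qed.

Lemma analytic_represents f : analytic_on_disc f -> exists a, represents f a.
Proof.
move=> /(_ 0 1 ltr01)[|c fc]; first by move=> z; rewrite subr0.
by exists c => z z1; have := fc z; rewrite subr0 => /(_ z1).
Qed.

(** Expansions at [z0] are expansions at 0 of the translates [f j (z0 + u)], to which [csum_bigprod]
    applies. *)
Lemma analytic_prod k (f : 'I_k -> R[i] -> R[i]) :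
  (forall j, analytic_on_disc (f j)) ->
  analytic_on_disc (fun z => \prod_(j < k) f j z).
Proof.
move=> fa z0 r r0 sub.
have /choice[c fc] := fun j => fa j z0 r r0 sub.
exists (cauchy_bigprod c) => z zr.
have := @csum_bigprod k (fun j u => f j (z0 + u)) c r _ (z - z0) zr.
rewrite (_ : \prod_(j < k) f j (z0 + (z - z0)) = \prod_(j < k) f j z); last first.
  by apply: eq_bigr => j _; rewrite addrC subrK.
apply => j u ur; have := fc j (z0 + u).
by rewrite (_ : z0 + u - z0 = u); [exact|rewrite addrC addKr].
Qed.

Lemma Anorm_sqnorm f a al X : 1 <= al -> represents f a -> sqnorm al a X ->
  Anorm 2 al f = (X `^ 2^-1)%:E.
Proof.
rewrite le_eqVlt => /predU1P[<-|al1] fa aX; rewrite /Anorm.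
  by rewrite eqxx; exact: hardy_norm_sqnorm aX.
by rewrite gt_eqF//; exact: bergman_norm_sqnorm aX.
Qed.

Lemma wsqD_le al a b n : 0 < al ->
  wsq al (fun n => a n + b n) n <= 2 * (wsq al a n + wsq al b n).
Proof.
move=> al0; rewrite /wsq -mulrDl mulrA ler_pM2r ?invr_gt0 ?cbin_gt0//.
have := cmodD (a n) (b n); have := cmod_ge0 (a n + b n).
have := sqr_ge0 (cmod (a n) - cmod (b n)).
have := cmod_ge0 (a n); have := cmod_ge0 (b n).
by move=> *; nra.
Qed.

Lemma Aspace_sqnorm f a al : 1 <= al -> represents f a -> Aspace 2 al f ->
  exists X, sqnorm al a X.
Proof.
rewrite le_eqVlt => /predU1P[<-|al1] fa [_].
  by rewrite eqxx; exact: hardy_norm_fin.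
(* One polynomial at distance less than 1 is enough: [a] differs by finitely many coefficients from
   a sequence of finite norm. *)
rewrite gt_eqF// => /(_ 1 ltr01)[P fP].
have al0 : 0 < al by rewrite (lt_trans ltr01).
pose b n := a n - P`_n.
have Pb : represents (fun z => f z - P.[z]) b.
  move=> z z1; have := csumB (fa z z1) (@csum_finite (fun n => P`_n * z ^+ n) (size P) _).
  rewrite -horner_coef => h; rewrite (_ : (fun n => _) = (fun n => a n * z ^+ n - P`_n * z ^+ n)).
    by apply: h => n Pn; rewrite nth_default ?mul0r.
  by apply/funext => n; rewrite mulrBl.
have [|Y bY] := bergman_norm_fin al1 Pb.
  by apply: lt_trans fP _; exact: ltry.
have w0 c n : 0 <= wsq al c n by exact: wsq_ge0.
have [||X aX _] := @psum_bounded _ (wsq al a)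
    (2 * (Y + \sum_(n < size P) wsq al (fun n => P`_n) n)) => //.
  move=> N; apply: (@le_trans _ _ (\sum_(n < N) 2 * (wsq al b n + wsq al (fun n => P`_n) n))).
    apply: ler_sum => i _; rewrite -[a in leLHS](_ : (fun n => b n + P`_n) = a).
      exact: wsqD_le.
    by apply/funext => n; rewrite /b subrK.
  rewrite -mulr_sumr ler_wpM2l// big_split lerD//; first exact: psum_le bY N.
  apply: le_trans (psum_nd (w0 _) (leq_maxl N (size P))) _.
  rewrite -!(big_mkord xpredT) (@big_cat_nat _ _ _ (size P) 0 (maxn N (size P)))//= ?leq_maxr//.
  rewrite [X in _ + X <= _]big_nat_cond [X in _ + X <= _]big1 ?addr0// => i /andP[/andP[Pi _] _].
  by rewrite /wsq nth_default// cmod0 expr0n mul0r.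
by exists X.
Qed.

(** In the Bergman case the Taylor polynomials approximate: the squared norm of the remainder is the
    tail of a convergent series. *)
Lemma sqnorm_Aspace f a al X : 1 <= al -> analytic_on_disc f ->
  represents f a -> sqnorm al a X -> Aspace 2 al f.
Proof.
move=> al1 af fa aX; split=> //; have al0 : 0 < al by rewrite (lt_le_trans ltr01).
move: al1; rewrite le_eqVlt => /predU1P[al1|al1].
  by rewrite -al1 eqxx in aX *; rewrite (hardy_norm_sqnorm fa aX) ltry.
rewrite gt_eqF// => e e0.
have e20 : 0 < e ^+ 2 by rewrite exprn_gt0.
have XeX : X - e ^+ 2 < X by rewrite ltrBlDr ltrDl.
have [N _ /(_ N (leqnn N))/= hN] := cvgr_gt X aX _ XeX.
exists (\poly_(i < N) a i).
pose b n := if (n < N)%N then 0 else a n.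
have fb : represents (fun z => f z - (\poly_(i < N) a i).[z]) b.
  move=> z z1; rewrite horner_poly.
  have := csumB (fa z z1) (@csum_finite (fun n => (if (n < N)%N then a n else 0) * z ^+ n) N _).
  rewrite (_ : \sum_(n < N) _ = \sum_(i < N) a i * z ^+ i); last first.
    by apply: eq_bigr => i _; rewrite ltn_ord.
  move=> h; rewrite (_ : (fun n => _) =
    (fun n => a n * z ^+ n - (if (n < N)%N then a n else 0) * z ^+ n)).
    by apply: h => n Nn; rewrite ltnNge Nn mul0r.
  by apply/funext => n; rewrite /b; case: ifP => _; rewrite ?subrr ?mul0r ?subr0.
have bX : sqnorm al b (X - \sum_(i < N) wsq al a i).
  rewrite /sqnorm; apply: cvg_trans (cvgB aX (cvg_cst (\sum_(i < N) wsq al a i))).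
  apply: near_eq_cvg; near=> n; have Nn : (N <= n)%N by near: n; exists N.
  rewrite fctE -!(big_mkord xpredT) !(@big_cat_nat _ _ _ N 0 n)//=.
  rewrite addrAC subrr add0r [X in _ = X + _]big_nat_cond [X in _ = X + _]big1 => [|i /andP[/andP[_ iN] _]].
    rewrite add0r big_nat_cond [RHS]big_nat_cond; apply: eq_bigr => i /andP[/andP[Ni _] _].
    by rewrite /wsq /b ltnNge Ni.
  by rewrite /wsq /b iN cmod0 expr0n mul0r.
rewrite (bergman_norm_sqnorm al1 fb bX) lte_fin.
have b0 : 0 <= X - \sum_(i < N) wsq al a i by exact: sqnorm_ge0 bX.
rewrite powR12_sqrt// -[ltRHS]gtr0_norm// -sqrtr_sqr ltr_sqrt//.
by rewrite ltrBlDr -ltrBlDl.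
Unshelve. all: by end_near. Qed.

Lemma prod_powR12 k (X : 'I_k -> R) : (forall j, 0 <= X j) ->
  (\prod_(j < k) (X j `^ 2^-1)%:E = ((\prod_(j < k) X j) `^ 2^-1)%:E)%E.
Proof.
move=> X0.
suff [] : 0 <= \prod_(j < k) X j /\
  (\prod_(j < k) (X j `^ 2^-1)%:E = ((\prod_(j < k) X j) `^ 2^-1)%:E)%E by [].
apply: (big_ind2 (fun x y => 0 <= x /\ y = (x `^ 2^-1)%:E)) => //.
- by rewrite powR1.
- by move=> x1 y1 x2 y2 [x10 ->] [x20 ->]; rewrite mulr_ge0// powRM// EFinM.
Qed.

End Spaces.

(** The necessity clause carries two restrictions: for [k = 1] equality holds for every function,
    and if some [f j] vanishes on the disc both sides are 0 whatever the other factors are. Hence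
    the two directions are stated apart. *)
Theorem lemma2 (R : realType) (k : nat) (f : 'I_k -> R[i] -> R[i])
    (alpha : 'I_k -> R) (hk : (0 < k)%N)
    (halpha : forall j, 1 <= alpha j)
    (hf : forall j, Aspace 2 (alpha j) (f j)) :
  let F := fun z : R[i] => \prod_(j < k) f j z in
  let A := \sum_(j < k) alpha j in
  let equality :=
    Anorm 2 A F = (\prod_(j < k) Anorm 2 (alpha j) (f j))%E in
  let extremal :=
    exists (lambda : 'I_k -> R[i]) (w : R[i]), disc w /\
      forall (j : 'I_k) (z : R[i]), disc z ->
        f j z = lambda j * cpow (1 - w * z) (- alpha j) in
  [/\ Aspace 2 A F,
      (Anorm 2 A F <= \prod_(j < k) Anorm 2 (alpha j) (f j))%E,
      extremal -> equality
    & (1 < k)%N -> (forall j, exists2 z, disc z & f j z != 0) ->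
      equality -> extremal].
Proof.
case: k hk f alpha halpha hf => // k _ f al al1 hf F A equality extremal.
have al0 j : 0 < al j by rewrite (lt_le_trans ltr01).
have A1 : 1 <= A.
  rewrite /A big_ord_recl; apply: le_trans (al1 ord0) _.
  by rewrite lerDl sumr_ge0// => j _; exact: ltW.
have af j : analytic_on_disc (f j) by have [] := hf j.
have /choice[a fa] := fun j => analytic_represents (af j).
have /choice[X aX] := fun j => Aspace_sqnorm (al1 j) (fa j) (hf j).
have X0 j : 0 <= X j by exact: sqnorm_ge0 (aX j).
have FB : represents F (cauchy_bigprod a) by exact: csum_bigprod.
have [Z BZ ZX] := sqnorm_bigprod al0 aX.
have Z0 : 0 <= Z by apply: sqnorm_ge0 BZ; exact: lt_le_trans A1.
have normF : Anorm 2 A F = (Z `^ 2^-1)%:E by exact: Anorm_sqnorm BZ.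
have normf : (\prod_(j < k.+1) Anorm 2 (al j) (f j))%E = ((\prod_j X j) `^ 2^-1)%:E.
  rewrite -prod_powR12//; apply: eq_bigr => j _.
  by rewrite (Anorm_sqnorm (al1 j) (fa j) (aX j)).
have PX0 : 0 <= \prod_j X j by apply: prodr_ge0.
split.
- by apply: (sqnorm_Aspace A1 _ FB BZ); exact: analytic_prod.
- by rewrite normF normf lee_fin ge0_ler_powR// nnegrE.
- move=> [lam [w [w1 fE]]].
  have fg j : represents (f j) (geo (al j) (lam j) w).
    by move=> z z1; rewrite fE//; exact: geo_csum.
  (* The norms are recomputed from the geometric sequences, which represent the [f j] just as the
     [a j] do. *)
  have /choice[Y gY] := fun j => Aspace_sqnorm (al1 j) (fg j) (hf j).
  have FG := csum_bigprod fg; rewrite cauchy_bigprod_geo in FG.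
  have GY := sqnorm_bigprod_geo al0 gY.
  rewrite /equality (Anorm_sqnorm A1 FG GY) -prod_powR12 => [|j].
    apply: eq_bigr => j _; rewrite (Anorm_sqnorm (al1 j) (fg j) (gY j))//.
  exact: sqnorm_ge0 (gY j).
move=> k1 fn0; have [m km] : exists m, k = m.+1 by exists k.-1; rewrite prednK.
subst k.
rewrite /equality normF normf => -[/powR_injective]; rewrite !nnegrE => eZ.
have {eZ} eZ : Z = \prod_j X j by apply: eZ.
have an0 j : exists n, a j n != 0.
  have [z z1 fz] := fn0 j; have [//|/forallNP az] := pselect (exists n, a j n != 0).
  move/eqP: fz => []; apply: (csum_unique (fa j z z1)).
  have := @csum_finite _ (fun n => a j n * z ^+ n) 0; rewrite big_ord0; apply => n _.
  by have /negP/negPn/eqP -> := az n; rewrite mul0r.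
rewrite eZ in BZ.
have [w aw] := sqnorm_bigprod_eq al0 an0 aX BZ.
have /choice[lam lamP] : forall j, exists lam, lam != 0 /\ a j = geo (al j) lam w.
  by move=> j; have [lam ? ?] := aw j; exists lam.
have w1 : cmod w < 1.
  have [l0 aE] := lamP ord0; apply: (@geo_ratio_lt1 _ (al ord0) (lam ord0) _ (X ord0)) => //.
  by rewrite -aE.
exists lam, w; split => // j z z1.
apply: (csum_unique (fa j z z1)); have [_ ->] := lamP j.
exact: geo_csum.
Qed.
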